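(* Let $\eta$ be an $\mathbb{N}$-valued random variable. If $\mathbf{P}[\eta\ge 1]>0$, then $p_c(\mathbb{Z}^d,\eta)<1$ for all $d\ge 2$.
   Context: Here $\mathbb{N}=\{0,1,2,\dots\}$, and $\mathbb{Z}^d$ denotes the graph with vertex set $\mathbb{Z}^d$ and edges between points at $\ell^1$-distance $1$, with root $\mathbf{0}$ the origin. Frog model $\mathrm{FM}(\mathcal{G},p,\eta)$. Let $\mathcal{G}$ be an infinite connected undirected graph all of whose sites (vertices) have finite degree, with a fixed site $\mathbf{0}$ called the root; let $p\in[0,1]$ and let $\eta$ be a random variable with values in $\mathbb{N}$. Let $\{\eta(x)\}_{x}$, $\{(S^x_n(i))_{n\in\mathbb{N}}\}_{x,\,i\ge1}$, $\{\Xi^x_p(i)\}_{x,\,i\ge 1}$ be independent families of independent random variables, where $\eta(x)$ has the law of $\eta$, $(S^x_n(i))_n$ is a discrete-time simple random walk on $\mathcal{G}$ started from $x$, and $\mathbf{P}[\Xi^x_p(i)=k]=(1-p)p^{k-1}$, $k=1,2,\dots$ (for $p=1$, $\Xi^x_p(i)=\infty$, no death). Site $x$ initially contains $\eta(x)$ particles; at time $0$ all particles are sleeping except those at the root, which are active. If the particles of site $x$ are activated at time $T(x)$, the $i$-th of them ($1\le i\le\eta(x)$) is active and located at $S^x_n(i)$ at time $T(x)+n$ for $0\le n<\Xi^x_p(i)$, and then disappears. When an active particle visits a site, all sleeping particles there become active. Formally, $t(x,y)=\min_{1\le i\le\eta(x)}\min\{n<\Xi^x_p(i):S^x_n(i)=y\}$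 for $x\ne y$ ($\infty$ if there is no such $n$), and $T(x)=\inf\{t(x_0,x_1)+\dots+t(x_{m-1},x_m)\}$ over all finite sequences $\mathbf{0}=x_0,x_1,\dots,x_m=x$, with $T(\mathbf{0})=0$; $T(x)=\infty$ means that $x$ is never visited by active particles. The model survives if at every time there is at least one active particle; otherwise it dies out. The critical parameter is $p_c(\mathcal{G},\eta)=\inf\{p\in[0,1]:\mathbf{P}[\mathrm{FM}(\mathcal{G},p,\eta)\text{ survives}]>0\}$. *)

(* Defs.v *)
From HB Require Import structures.
From mathcomp Require Import all_boot all_order all_algebra finmap.
From mathcomp Require Import all_classical all_reals all_analysis.
From mathcomp Require Import measurable_realfun.

Set Implicit Arguments.
Unset Strict Implicit.
Unset Printing Implicit Defensive.

Import Order.TTheory GRing.Theory Num.Theory.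

Local Open Scope classical_set_scope.
Local Open Scope ring_scope.

Section Graph.
Context {V : countType}.

(* Meaningful for locally finite graphs only: [fset_set] sends an infinite set
   to the empty one. *)
Definition degree (adj : rel V) (x : V) : nat :=
  #|` fset_set [set y | adj x y] |.

Definition srw_step {R : realType} (adj : rel V) (x y : V) : R :=
  if adj x y then (degree adj x)%:R^-1 else 0.

End Graph.

Section Probability.
Context {R : realType} {d : measure_display} {Omega : measurableType d}.
Variable P : probability Omega R.

Definition independent_systems {I : choiceType} (F : I -> set (set Omega)) :=
  forall (J : {fset I}) (A : I -> set Omega),
    (forall i, i \in J -> F i (A i)) ->
    P (\bigcap_(i in [set` J]) A i) = (\prod_(i <- J) P (A i))%E.

(* The sigma-algebra generated by a process with values in a countable set. *)
Definition sigma_process {V : countType} (S : nat -> Omega -> V) :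
    set (set Omega) :=
  <<s [set A | exists n y, A = S n @^-1` [set y]] >>.

(* The second field is the Markov property with transition matrix [srw_step],
   written as a product so as to avoid conditioning on null events. *)
Record simple_random_walk {V : countType} (adj : rel V) (x : V)
    (S : nat -> Omega -> V) : Prop := SimpleRandomWalk {
  srw_measurable : forall n y, measurable (S n @^-1` [set y]) ;
  srw_start : P [set w | S 0%N w = x] = 1%E ;
  srw_markov : forall (v : nat -> V) (n : nat),
    P [set w | forall k, (k <= n.+1)%N -> S k w = v k] =
    (P [set w | forall k, (k <= n)%N -> S k w = v k] *
     (srw_step adj (v n) (v n.+1))%:E)%E }.

Record geometric_lifetime (p : R) (X : {RV P >-> \bar R}) : Prop :=
  GeometricLifetime {
  lifetime_pmf : forall k : nat, (1 <= k)%N ->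
    P [set w | X w = k%:R%:E] = ((1 - p) * p ^+ k.-1)%:E ;
  lifetime_immortal : p = 1 -> P [set w | X w = +oo%E] = 1%E }.

End Probability.

Section FrogModel.
Context {R : realType} {V : countType}.
Variables (adj : rel V) (root : V).

Section Realization.
Context {d : measure_display} {Omega : measurableType d}.
Variable P : probability Omega R.
(* The particles of site [x] are numbered [0, ..., eta x w - 1]. *)
Variables (eta : V -> {RV P >-> nat}) (S : V -> nat -> nat -> Omega -> V)
          (Xi : V -> nat -> {RV P >-> \bar R}).

Definition frog_sigma (j : V + (V * nat) + (V * nat)) : set (set Omega) :=
  match j with
  | inl (inl x) => g_sigma_algebra_preimage (eta x)
  | inl (inr (x, i)) => sigma_process (S x i)
  | inr (x, i) => g_sigma_algebra_preimage (Xi x i)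
  end.

(* [mu] is the law of the initial number of particles at a site. *)
Record frog_model (p : R) (mu : probability nat R) : Prop := FrogModel {
  frog_eta : forall x A, distribution P (eta x) A = mu A ;
  frog_walk : forall x i, simple_random_walk P adj x (S x i) ;
  frog_lifetime : forall x i, geometric_lifetime p (Xi x i) ;
  frog_independent : independent_systems P frog_sigma }.

(* For [x = y] this is [0] or [+oo], so that repetitions in the sequences
   below do not matter. *)
Definition hitting_time (w : Omega) (x y : V) : \bar R :=
  ereal_inf [set n%:R%:E | n in [set n : nat | exists i : nat,
    [/\ (i < eta x w)%N, (n%:R%:E < Xi x i w)%E & S x i n w = y]]].

Definition activation_time (w : Omega) (x : V) : \bar R :=
  ereal_inf [set (\sum_(e <- zip (root :: s) s) hitting_time w e.1 e.2)%E
            | s in [set s : seq V | last root s = x]].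

(* A site [x] with activation time [m] has an active particle at time [n]. *)
Definition active_particle (w : Omega) (n : nat) (x : V) (i : nat) : Prop :=
  (i < eta x w)%N /\ exists2 m : nat, activation_time w x = m%:R%:E &
    (m <= n)%N /\ ((n - m)%:R%:E < Xi x i w)%E.

Definition survival : set Omega :=
  [set w | forall n : nat, exists x i, active_particle w n x i].

End Realization.

(* [frog_model] determines the joint law of [eta], [S] and [Xi], hence the
   value of [P survival], and realizations exist, as countably many independent
   variables are involved: "in every realization" amounts to "in some". *)
Definition survives_with_positive_probability
    (p : R) (mu : probability nat R) : Prop :=
  forall (d : measure_display) (Omega : measurableType d)
    (P : probability Omega R) (eta : V -> {RV P >-> nat})
    (S : V -> nat -> nat -> Omega -> V) (Xi : V -> nat -> {RV P >-> \bar R}),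
    frog_model eta S Xi p mu -> (0 < P (survival eta S Xi))%E.

(* The infimum is taken in [\bar R], where that of the empty set is [+oo];
   in [R] it would be [0]. *)
Definition critical_parameter (mu : probability nat R) : \bar R :=
  ereal_inf [set p%:E | p in [set p : R | 0 <= p <= 1 /\
    survives_with_positive_probability p mu]].

End FrogModel.

Definition Zd_adj (d : nat) : rel 'rV[int]_d :=
  fun x y => \sum_(i < d) `|x 0 i - y 0 i| == 1.

(* Main.v *)
(** Only the first particle of each site is used. Project Z^d to two coordinates and
cut the plane into square blocks of side of order [r]. A particle living at
least [L] steps, with [L] large in terms of [r], visits [r] distinct sites of
a neighbouring block with a probability bounded below by a constant that does
not depend on [r]: by symmetry the walk leaves a square through any given
half side with probability at least 1/16, so a bounded number of such exits
steers it into the target block, which it cannot leave before having met [r]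
distinct distances from its entrance point. Hence if [r] sites of a block are
activated, their particles activate [r] sites in each of the four neighbouring
blocks except with probability exponentially small in [r].

Exploring the blocks one after the other, each with fresh particles, any given
set of [j] blocks is found to be bad with probability at most [delta ^ j].
Group the blocks into 3 x 3 squares, called bad if they contain two bad
blocks, and iterate. A square of level [k] is bad with probability decreasing
geometrically in [k], and the good blocks whose ancestors are all good are
connected inside a good square, because eight cells of a 3 x 3 square are
connected and touch the eight cells of an adjacent one. So the origin activates
sites at arbitrary distance with probability bounded below, and since a site
at distance [n] is not activated before time [n], the process survives. *)
Require Import Defs.
From mathcomp Require Import all_boot all_order perm all_algebra finmap.
From mathcomp Require Import all_classical all_reals all_analysis.
From mathcomp Require Import measurable_realfun.
From mathcomp Require Import zify ring lra.

Set Implicit Arguments.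
Unset Strict Implicit.
Unset Printing Implicit Defensive.

Import Order.TTheory GRing.Theory Num.Theory.
Local Open Scope ring_scope.

(** * Hierarchical site percolation *)

Definition block := (nat * nat)%type.

(* The truncated predecessor makes a block on an axis its own neighbour. *)
Definition neighbours (b : block) : seq block :=
  [:: (b.1.+1, b.2); (b.1.-1, b.2); (b.1, b.2.+1); (b.1, b.2.-1)].

Definition parent (b : block) : block := ((b.1 %/ 3)%N, (b.2 %/ 3)%N).

Definition child (u : block) (c : 'I_3 * 'I_3) : block :=
  ((3 * u.1 + c.1)%N, (3 * u.2 + c.2)%N).

Definition coarsen (bad : pred block) : pred block := fun u =>
  [exists c : ('I_3 * 'I_3) * ('I_3 * 'I_3),
     [&& c.1 != c.2, bad (child u c.1) & bad (child u c.2)]].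

(** Only the blocks after the first have to be good, which makes reflexivity unconditional; goodness
    of the first block then propagates along the chain. *)
Inductive block_connected (bad : pred block) : block -> block -> Prop :=
| linked_blocks_refl b : block_connected bad b b
| linked_blocks_step b b1 b2 : block_connected bad b b1 -> b2 \in neighbours b1 ->
    ~~ bad b2 -> block_connected bad b b2.

Lemma linked_blocks_trans bad b1 b2 b3 :
  block_connected bad b1 b2 -> block_connected bad b2 b3 -> block_connected bad b1 b3.
Proof.
move=> h12 h23; elim: h23 h12 => // b b' b'' _ IH hn hb h.
exact: linked_blocks_step (IH h) hn hb.
Qed.

Lemma linked_blocks_open bad b b' : block_connected bad b b' -> ~~ bad b -> ~~ bad b'.
Proof. by case. Qed.

Lemma childP u b : parent b = u -> exists c, b = child u c.
Proof.
move=> <-; exists (inord (b.1 %% 3), inord (b.2 %% 3)).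
rewrite /child /parent /= !inordK ?ltn_pmod //.
by case: b => x y /=; congr (_, _); rewrite mulnC -divn_eq.
Qed.

Lemma parent_child u c : parent (child u c) = u.
Proof.
by case: u => x y; rewrite /parent /child /=; congr (_, _);
   rewrite mulnC divnMDl // divn_small ?addn0.
Qed.

Lemma coarsenP bad u c c' : ~~ coarsen bad u -> c != c' ->
  ~~ bad (child u c) || ~~ bad (child u c').
Proof.
move=> /existsPn/(_ (c, c')) /=; rewrite !negb_and => + cc'.
by rewrite cc'.
Qed.

Definition o0 : 'I_3 := ord0.
Definition o1 : 'I_3 := @Ordinal 3 1 isT.
Definition o2 : 'I_3 := ord_max.

Lemma ord3P (P : 'I_3 -> Prop) : P o0 -> P o1 -> P o2 -> forall i, P i.
Proof.
move=> p0 p1 p2 [[|[|[|n]]] hn] //.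
- by have -> : Ordinal hn = o0 by apply: val_inj.
- by have -> : Ordinal hn = o1 by apply: val_inj.
- by have -> : Ordinal hn = o2 by apply: val_inj.
Qed.

(** * Connectivity of the good cells inside a good square and across a side *)

Section Box.
Variables (bad : pred block) (u : block).
Local Notation open c := (~~ bad (child u c)).
Local Notation linked c c' := (block_connected bad (child u c) (child u c')).

Lemma linked_succ1 (i i' j : 'I_3) : i.+1 = i' :> nat -> open (i', j) ->
  linked (i, j) (i', j).
Proof.
move=> h; apply: linked_blocks_step; first exact: linked_blocks_refl.
by rewrite !inE /child /= -h addnS eqxx.
Qed.

Lemma linked_pred1 (i i' j : 'I_3) : i'.+1 = i :> nat -> open (i', j) ->
  linked (i, j) (i', j).
Proof.
move=> h; apply: linked_blocks_step; first exact: linked_blocks_refl.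
by rewrite !inE /child /= -h addnS /= eqxx orbT.
Qed.

Lemma linked_succ2 (i j j' : 'I_3) : j.+1 = j' :> nat -> open (i, j') ->
  linked (i, j) (i, j').
Proof.
move=> h; apply: linked_blocks_step; first exact: linked_blocks_refl.
by rewrite !inE /child /= -h addnS eqxx !orbT.
Qed.

Lemma linked_pred2 (i j j' : 'I_3) : j'.+1 = j :> nat -> open (i, j') ->
  linked (i, j) (i, j').
Proof.
move=> h; apply: linked_blocks_step; first exact: linked_blocks_refl.
by rewrite !inE /child /= -h addnS /= eqxx !orbT.
Qed.

Lemma linked_col j : (forall i, open (i, j)) -> forall i i', linked (i, j) (i', j).
Proof.
move=> h; elim/ord3P; elim/ord3P;
  try exact: linked_blocks_refl;
  try exact: linked_succ1; try exact: linked_pred1.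
- by apply: (@linked_blocks_trans _ _ (child u (o1, j)));
    [exact: linked_succ1|exact: linked_succ1].
- by apply: (@linked_blocks_trans _ _ (child u (o1, j)));
    [exact: linked_pred1|exact: linked_pred1].
Qed.

Lemma linked_row i : (forall j, open (i, j)) -> forall j j', linked (i, j) (i, j').
Proof.
move=> h; elim/ord3P; elim/ord3P;
  try exact: linked_blocks_refl;
  try exact: linked_succ2; try exact: linked_pred2.
- by apply: (@linked_blocks_trans _ _ (child u (i, o1)));
    [exact: linked_succ2|exact: linked_succ2].
- by apply: (@linked_blocks_trans _ _ (child u (i, o1)));
    [exact: linked_pred2|exact: linked_pred2].
Qed.

Hypothesis hu : ~~ coarsen bad u.

(** A good square has at most one bad cell. If the line [(i, _)] contains it, it does not lie on the
    crossing line [(_, j)], since [(i, j)] itself is good. *)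
Lemma open_line i j : open (i, j) ->
  (forall j', open (i, j')) \/ (forall i', open (i', j)).
Proof.
move=> hij.
have [/forallP|] := boolP [forall j', open (i, j')]; first by left.
move=> /forallPn[j' hj']; right=> i'; apply/negP => hi'.
have ne : (i, j') != (i', j).
  by apply: contra hij => /eqP[_ <-]; rewrite negbK in hj'.
by have := coarsenP hu ne; rewrite hi' orbF (negPf hj').
Qed.

Lemma open_col : exists j, forall i, open (i, j).
Proof.
have [/forallP h|] := boolP [forall i, open (i, o0)]; first by exists o0.
move=> /forallPn[i0 hi0]; exists o1 => i.
by have := @coarsenP bad u (i0, o0) (i, o1) hu; rewrite xpair_eqE andbF (negPf hi0); apply.
Qed.

Lemma open_row : exists i, forall j, open (i, j).
Proof.
have [/forallP h|] := boolP [forall j, open (o0, j)]; first by exists o0.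
move=> /forallPn[j0 hj0]; exists o1 => j.
by have := @coarsenP bad u (o0, j0) (o1, j) hu; rewrite xpair_eqE (negPf hj0); apply.
Qed.

(** Each good cell lies on an entirely good line. Two crossing lines meet; two parallel ones are
    joined by a good line in the other direction. *)
Lemma linked_box c c' : open c -> open c' -> linked c c'.
Proof.
case: c c' => [i j] [i' j'] hc hc'.
have [hi|hj] := open_line hc; have [hi'|hj'] := open_line hc'.
- have [k hk] := open_col.
  apply: (linked_blocks_trans (linked_row hi j k)).
  exact: (linked_blocks_trans (linked_col hk i i')) (linked_row hi' k j').
- exact: linked_blocks_trans (linked_row hi j j') (linked_col hj' i i').
- exact: linked_blocks_trans (linked_col hj i i') (linked_row hi' j j').
- have [k hk] := open_row.
  apply: (linked_blocks_trans (linked_col hj i k)).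
  exact: (linked_blocks_trans (linked_row hk j j')) (linked_col hj' k i').
Qed.

End Box.

(** Here [f] and [f'] list the cells of two facing sides. Each side has at most one bad cell, so at
    most two of the three facing pairs are blocked. *)
Lemma facing bad u u' (f f' : 'I_3 -> 'I_3 * 'I_3) :
  injective f -> injective f' -> ~~ coarsen bad u -> ~~ coarsen bad u' ->
  exists j, ~~ bad (child u (f j)) /\ ~~ bad (child u' (f' j)).
Proof.
move=> fi f'i hu hu'.
have h j j' : j != j' ->
    ~~ bad (child u (f j)) || ~~ bad (child u (f j')).
  by move=> jj'; apply: coarsenP; rewrite ?inj_eq.
have h' j j' : j != j' ->
    ~~ bad (child u' (f' j)) || ~~ bad (child u' (f' j')).
  by move=> jj'; apply: coarsenP; rewrite ?inj_eq.
have := h o0 o1 isT; have := h o0 o2 isT; have := h o1 o2 isT.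
have := h' o0 o1 isT; have := h' o0 o2 isT; have := h' o1 o2 isT.
case b0: (bad (child u (f o0))) => /=; case b0': (bad (child u' (f' o0))) => /=;
case b1: (bad (child u (f o1))) => //=; case b1': (bad (child u' (f' o1))) => //= *;
by [exists o0; rewrite b0 b0'|exists o1; rewrite b1 b1'|exists o2].
Qed.

Lemma linked_blocks_children bad u u' b b' : u' \in neighbours u ->
  ~~ coarsen bad u -> ~~ coarsen bad u' -> parent b = u -> parent b' = u' ->
  ~~ bad b -> ~~ bad b' -> block_connected bad b b'.
Proof.
move=> huu' hu hu' /childP[c ->] /childP[c' ->] hc hc'.
have join (f f' : 'I_3 -> 'I_3 * 'I_3) : injective f -> injective f' ->
    (forall j, child u' (f' j) \in neighbours (child u (f j))) ->
    block_connected bad (child u c) (child u' c').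
  move=> fi f'i hf; have [j [hj hj']] := facing fi f'i hu hu'.
  apply: linked_blocks_trans (linked_box hu' hj' hc').
  exact: linked_blocks_step (linked_box hu hc hj) (hf j) hj'.
have i1 k : injective (fun j : 'I_3 => (k, j) : 'I_3 * 'I_3) by move=> ? ? [].
have i2 k : injective (fun j : 'I_3 => (j, k) : 'I_3 * 'I_3) by move=> ? ? [].
move: huu' hu' hc' join; rewrite !inE.
(* On an axis the truncated predecessor gives [u' = u], and the square itself does the job. *)
have same : u' = u -> ~~ coarsen bad u' -> ~~ bad (child u' c') ->
    block_connected bad (child u c) (child u' c').
  by move=> -> h' h''; exact: linked_box.
case/or4P=> /eqP eu' hu' hc' join.
- apply: (join _ _ (i1 o2) (i1 o0)) => j; rewrite eu' !inE /child /=.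
  rewrite (_ : 3 * u.1.+1 + 0 = (3 * u.1 + 2).+1)%N ?eqxx //; lia.
- have [z|p] := posnP u.1.
    by apply: same; rewrite // eu' z; case: (u) z => x y /= ->.
  apply: (join _ _ (i1 o0) (i1 o2)) => j; rewrite eu' !inE /child /=.
  rewrite (_ : 3 * u.1.-1 + 2 = (3 * u.1 + 0).-1)%N ?eqxx ?orbT //; lia.
- apply: (join _ _ (i2 o2) (i2 o0)) => j; rewrite eu' !inE /child /=.
  rewrite (_ : 3 * u.2.+1 + 0 = (3 * u.2 + 2).+1)%N ?eqxx ?orbT //; lia.
- have [z|p] := posnP u.2.
    by apply: same; rewrite // eu' z; case: (u) z => x y /= ->.
  apply: (join _ _ (i2 o0) (i2 o2)) => j; rewrite eu' !inE /child /=.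
  rewrite (_ : 3 * u.2.-1 + 2 = (3 * u.2 + 0).-1)%N ?eqxx ?orbT //; lia.
Qed.

(** Two cells with first index 1 are tried, and one of them is good. Index 1 rather than 0 gives the
    strict inequality, which makes the first coordinate grow with the levels. *)
Lemma open_child bad u : ~~ coarsen bad u ->
  exists2 b, parent b = u & ~~ bad b /\ (3 * u.1 < b.1)%N.
Proof.
move=> hu; have := @coarsenP bad u (o1, o0) (o1, o1) hu isT.
by case/orP => h; [exists (child u (o1, o0))|exists (child u (o1, o1))];
  rewrite ?parent_child //; split; rewrite //= addn1.
Qed.

(** Pick a good cell in every square of the coarse chain and join the successive ones. *)
Lemma linked_blocks_coarsen bad u u' b b' : block_connected (coarsen bad) u u' ->
  ~~ coarsen bad u -> parent b = u -> parent b' = u' ->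
  ~~ bad b -> ~~ bad b' -> block_connected bad b b'.
Proof.
move=> h; elim: h b' => {u u'} [u b' hu|u u1 u2 h IH hn hu2 b' hu].
  by move=> /childP[c ->] /childP[c' ->]; apply: linked_box.
move=> hb hb' ob ob'; have hu1 := linked_blocks_open h hu.
have [b1 pb1 [ob1 _]] := open_child hu1.
apply: linked_blocks_trans (IH b1 hu hb pb1 ob ob1) _.
exact: linked_blocks_children hn hu1 hu2 pb1 hb' ob1 ob'.
Qed.

(** * Blocks whose ancestors are all good *)

Fixpoint lineage_open (bad : pred block) k b : bool :=
  if k is k'.+1 then ~~ bad b && lineage_open (coarsen bad) k' (parent b)
  else ~~ bad b.

Lemma lineage_open0 bad k b : lineage_open bad k b -> ~~ bad b.
Proof. by case: k => [|k] //= /andP[]. Qed.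

(** At level [k] the two ancestors coincide; the connection is then carried down one level at a
    time. *)
Lemma lineage_connected k bad b b' : lineage_open bad k b ->
  lineage_open bad k b' -> iter k parent b = iter k parent b' ->
  block_connected bad b b'.
Proof.
elim: k bad b b' => [|k IH] bad b b' /=.
  by move=> _ _ ->; exact: linked_blocks_refl.
move=> /andP[hb lb] /andP[hb' lb']; rewrite -!iterS !iterSr => e.
apply: (linked_blocks_coarsen (IH _ _ _ lb lb' e)) => //.
exact: lineage_open0 lb.
Qed.

Lemma iter_parent0 k : iter k parent (0, 0)%N = (0, 0)%N.
Proof. by elim: k => //= k ->. Qed.

Lemma lineage_far k bad : lineage_open bad k (0, 0)%N ->
  exists b, [/\ lineage_open bad k b, iter k parent b = (0, 0)%N & (k <= b.1)%N].
Proof.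
elim: k bad => [|k IH] bad /=; first by exists (0, 0)%N.
case/andP=> h0 /IH[u [lu iu hu]].
have [b pb [ob hb]] := open_child (lineage_open0 lu).
exists b; rewrite ob pb lu; split=> //; last lia.
by rewrite -iterS iterSr pb.
Qed.

(** The block [(0, 0)] is its own parent, so a failure of its lineage is badness of [(0, 0)] at some
    level. *)
Lemma lineage_openPn bad k : ~~ lineage_open bad k (0, 0)%N ->
  exists j : 'I_k.+1, iter j coarsen bad (0, 0)%N.
Proof.
elim: k bad => [|k IH] bad /=; first by rewrite negbK; exists ord0.
rewrite negb_and negbK => /orP[h|/IH[j hj]]; first by exists ord0.
exists (lift ord0 j); rewrite lift0.
by rewrite iterSr.
Qed.

Definition inside k (b : block) := (b.1 < 3 ^ k)%N && (b.2 < 3 ^ k)%N.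

Lemma inside_child k u c : inside k u -> inside k.+1 (child u c).
Proof.
case: c => -[i hi] [j hj] /andP[h1 h2]; rewrite /inside /= expnS; apply/andP.
by split; lia.
Qed.

(** * Decay of the probability of bad squares along the levels *)

Section Domination.
Variable (R : realFieldType) (E : (pred block -> R) -> R).
Hypothesis E_mono : forall f g, (forall X, f X <= g X) -> E f <= E g.
Hypothesis E_sum : forall (I : finType) (Q : pred I) (f : I -> pred block -> R),
  E (fun X => \sum_(i | Q i) f i X) = \sum_(i | Q i) E (f i).

(** [E] stands for the expectation over the random set [X] of bad blocks, and [T X] is the set of
    bad squares of some level. The bound is asked only in a finite window, as only finitely many
    blocks are explored. *)
Definition dominated (T : pred block -> pred block) (k : nat) (a : R) :=
  forall J, uniq J -> all (inside k) J -> E (fun X => (all (T X) J)%:R) <= a ^+ size J.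

(** A bad square contains two bad cells, chosen among at most 81 pairs, and distinct squares have
    disjoint cells: a union bound turns [a] into [81 a^2] per square. *)
Lemma dominated_coarsen T k a : 0 <= a -> dominated T k.+1 a ->
  dominated (coarsen \o T) k (81%:R * a ^+ 2).
Proof.
move=> a0 hT J uJ iJ.
(* Squares are opened one by one: [J] holds those still to be opened, [K] the cells already chosen,
   which lie outside the squares of [J]. *)
suff H K : uniq K -> all (inside k.+1) K ->
    (forall b, b \in K -> parent b \notin J) ->
    E (fun X => (all (coarsen (T X)) J && all (T X) K)%:R)
      <= (81%:R * a ^+ 2) ^+ size J * a ^+ size K.
  have := H [::] isT isT (fun _ => ltac:(done)); rewrite expr0 mulr1.
  by apply: le_trans; apply: E_mono => X; rewrite andbT.
elim: J uJ iJ K => [|u J IH] /= => [_ _|/andP[nuJ uJ] /andP[iu iJ]] K uK iK hK.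
  by rewrite expr0 mul1r; apply: hT.
set PP := fun c : ('I_3 * 'I_3) * ('I_3 * 'I_3) => c.1 != c.2.
apply: (@le_trans _ _ (\sum_(c | PP c) E (fun X =>
   (all (coarsen (T X)) J && all (T X) [:: child u c.1, child u c.2 & K])%:R))).
  rewrite -E_sum; apply: E_mono => X.
  have [|_] := boolP (_ && _); last by rewrite sumr_ge0.
  case/andP=> /andP[/existsP[c /and3P[h1 h2 h3]] hJ] hXK.
  rewrite (bigD1 c) //= h2 h3 hJ hXK /= lerDl.
  by rewrite sumr_ge0.
have hb (c : ('I_3 * 'I_3) * ('I_3 * 'I_3)) : PP c -> E (fun X =>
   (all (coarsen (T X)) J && all (T X) [:: child u c.1, child u c.2 & K])%:R)
   <= (81%:R * a ^+ 2) ^+ size J * a ^+ (size K).+2.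
  move=> hc; apply: IH => //=.
  - rewrite uK andbT inE negb_or; apply/andP; split; first apply/andP; try split.
    + apply: contra hc => /eqP e; apply/eqP; case: c e => -[i j] [i' j'] [].
      by move=> /= /addnI/val_inj -> /addnI/val_inj ->.
    + by apply/negP => /hK; rewrite parent_child inE eqxx.
    + by apply/negP => /hK; rewrite parent_child inE eqxx.
  - by rewrite !inside_child.
  - move=> b; rewrite !inE => /or3P[/eqP->|/eqP->|/hK]; rewrite ?parent_child //.
    by rewrite inE negb_or => /andP[].
apply: (le_trans (ler_sum _ hb)).
rewrite sumr_const.
have a2 : 0 <= (81%:R * a ^+ 2) ^+ size J * a ^+ (size K).+2.
  by rewrite mulr_ge0 ?exprn_ge0 // mulr_ge0 ?exprn_ge0.
apply: (@le_trans _ _ (((81%:R * a ^+ 2) ^+ size J * a ^+ (size K).+2) *+ 81)).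
  apply: ler_wpMn2l => //.
  apply: (leq_trans (max_card _)); by rewrite !card_prod !card_ord.
rewrite le_eqVlt; apply/orP; left; apply/eqP.
rewrite -mulr_natr !exprS; ring.
Qed.

(** As long as the current bound is at most [a], one has [81 a_j^2 <= (81 a) a_j <= a_j / 4]. *)
Lemma dominated_iter (a : R) k j : 0 <= a -> 81%:R * a <= 4%:R^-1 ->
  dominated id (k + j) a ->
  dominated (iter j coarsen) k (a / 4%:R ^+ j).
Proof.
move=> a0 ha; elim: j k => [|j IH] k; first by rewrite addn0 expr0 divr1.
rewrite addnS -addSn => /IH h.
have q0 : (0 : R) < 4%:R ^+ j by rewrite exprn_gt0.
have aj0 : 0 <= a / 4%:R ^+ j by rewrite divr_ge0 // ltW.
have := dominated_coarsen aj0 h.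
move=> h' J uJ iJ; apply: le_trans (h' J uJ iJ) _.
have q1 : a / 4%:R ^+ j <= a.
  rewrite ler_pdivrMr // ler_peMr //; apply: exprn_ege1; lra.
rewrite lerXn2r ?nnegrE ?mulr_ge0 ?exprn_ge0 ?divr_ge0 ?invr_ge0 ?exprn_ge0 //.
have e : a / 4%:R ^+ j.+1 = a / 4%:R ^+ j * 4%:R^-1.
  by rewrite exprS invfM [4%:R^-1 * _]mulrC mulrA.
rewrite e expr2 mulrA mulrC ler_wpM2l //.
by apply: le_trans ha; rewrite ler_wpM2l.
Qed.

(** Union bound over the levels: the lineage fails with probability at most the sum of the
    [a / 4^j], which is below [2 a], far less than one half. *)
Lemma dominated_lineage (a : R) k : 0 <= a -> 81%:R * a <= 4%:R^-1 ->
  E (fun=> 1) = 1 -> dominated id k a ->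
  2%:R^-1 <= E (fun X => (lineage_open X k (0, 0)%N)%:R).
Proof.
move=> a0 ha E1 hd.
have hj (j : 'I_k.+1) : E (fun X => (iter j coarsen X (0, 0)%N)%:R) <= a / 4%:R ^+ j.
  have hjk : (k - j + j = k)%N by rewrite subnK // -ltnS.
  rewrite -hjk in hd; have := dominated_iter a0 ha hd.
  move=> /(_ [:: (0, 0)%N] isT); rewrite /= andbT /inside /= !expn_gt0 => /(_ isT).
  by rewrite expr1; apply: le_trans; apply: E_mono => X; rewrite andbT.
have h : E (fun=> 1) <= E (fun X => (lineage_open X k (0, 0)%N)%:R) +
    \sum_(j < k.+1) E (fun X => (iter j coarsen X (0, 0)%N)%:R).
  (* [None] stands for the good lineage, [Some j] for a failure at level [j]. *)
  pose f (i : option 'I_k.+1) (X : pred block) : R :=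
    if i is Some j then (iter j coarsen X (0, 0)%N)%:R
    else (lineage_open X k (0, 0)%N)%:R.
  have -> : E (fun X => (lineage_open X k (0, 0)%N)%:R) +
    \sum_(j < k.+1) E (fun X => (iter j coarsen X (0, 0)%N)%:R) =
    \sum_(i | predT i) E (f i).
    rewrite (bigD1 None) //=; congr (_ + _).
    rewrite [RHS](reindex_omap Some id) /=; last by case.
    by apply: eq_bigl => j; rewrite eqxx.
  rewrite -E_sum; apply: E_mono => X; rewrite (bigD1 None) //=.
  have [_|/lineage_openPn[j hj']] := boolP (lineage_open X k _).
    by rewrite lerDl sumr_ge0 // => -[].
  rewrite add0r (bigD1 (Some j)) //= hj' lerDl sumr_ge0 // => -[i|] _ //=.
have hs : \sum_(j < k.+1) E (fun X => (iter j coarsen X (0, 0)%N)%:R) <= 2%:R^-1.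
  apply: (@le_trans _ _ (\sum_(j < k.+1) a / 4%:R ^+ j)).
    by apply: ler_sum => j _; exact: hj.
  (* The factor 2 exceeds the exact 4/3 and leaves room for an induction by linear arithmetic. *)
  have hs n : \sum_(j < n) a / 4%:R ^+ j <= 2%:R * a - 2%:R * a / 4%:R ^+ n.
    elim: n => [|n IHn]; first by rewrite big_ord0 expr0 divr1 subrr.
    rewrite big_ord_recr /= exprS invfM.
    have : 0 <= a / 4%:R ^+ n by rewrite divr_ge0 ?exprn_ge0.
    move: IHn; rewrite -!mulrA [4%:R^-1 * _]mulrC ![a * (_ * _)]mulrA.
    set y := a / _; set z := \sum_(_ < _) _; lra.
  apply: le_trans (hs _) _.
  have : 0 <= 2%:R * a / 4%:R ^+ k.+1 by rewrite divr_ge0 ?exprn_ge0 ?mulr_ge0.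
  lra.
move: h; rewrite E1; lra.
Qed.

End Domination.

(** * Exploration of the blocks *)

Lemma size_inside k (s : seq block) : uniq s -> all (inside k) s ->
  (size s <= 3 ^ k * 3 ^ k)%N.
Proof.
move=> us /allP is_; rewrite -{1}(size_iota 0 (3 ^ k)) -{2}(size_iota 0 (3 ^ k)).
rewrite -(size_allpairs pair); apply: uniq_leq_size => // -[x y] /is_ /andP[/= hx hy].
by apply/allpairsP; exists (x, y); rewrite !mem_iota.
Qed.

Section Exploration.
Variables (R : realFieldType) (V : eqType) (O : finType) (mu : V -> O -> R).
Variables (m k : nat).
Hypothesis mu_ge0 : forall x o, 0 <= mu x o.
Hypothesis mu_sum1 : forall x, \sum_o mu x o = 1.
Variables (box : block -> pred V) (visits : V -> O -> pred V).
Hypothesis box_inj : forall b b' x, box b x -> box b' x -> b = b'.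
Variable spread : block -> V -> O -> option (m.-tuple V).
Hypothesis spreadP : forall b x o M, spread b x o = Some M ->
  uniq M /\ {in M, forall y, box b y /\ visits x o y}.

Local Notation outcomes := {ffun 'I_m -> O}.

(* A pending block carries [m] activated sites whose particles have not been
   looked at yet. *)
Record state := State {
  pending : seq (block * m.-tuple V) ; explored : seq block ; bad : seq block }.

Definition known s := explored s ++ map fst (pending s).

Definition good b (M : m.-tuple V) (g : outcomes) :=
  all (fun b' => [exists i, spread b' (tnth M i) (g i)]) (neighbours b).

(** The sites of [b'] on which the next step will rely. The default [M] does not occur for a
    neighbour of a good block, by [landingP]. *)
Definition landing (M : m.-tuple V) (g : outcomes) b' : m.-tuple V :=
  odflt M (obind (fun i => spread b' (tnth M i) (g i))
    [pick i | spread b' (tnth M i) (g i) : bool]).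

(** Blocks already known are skipped, so each block is explored once, with fresh particles; the
    window keeps the exploration finite. Neighbours may coincide at the corner, whence [undup]. *)
Definition discovered s b :=
  [seq b' <- undup (neighbours b) | inside k b' && (b' \notin known s)].

Definition explore s g : state :=
  if pending s is (b, M) :: rest then
    if good b M g then
      State (rest ++ [seq (b', landing M g b') | b' <- discovered s b])
            (b :: explored s) (bad s)
    else State rest (b :: explored s) (b :: bad s)
  else s.

Definition weight (M : m.-tuple V) (g : outcomes) : R :=
  \prod_i mu (tnth M i) (g i).

(** Expectation of [f] at the state reached after [n] explorations, or earlier when nothing is
    pending; every exploration draws new independent outcomes. *)
Fixpoint expect n s (f : state -> R) : R :=
  if n is n'.+1 then
    if pending s is (b, M) :: _ then
      \sum_g weight M g * expect n' (explore s g) f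
    else f s
  else f s.

Lemma weight_ge0 M g : 0 <= weight M g.
Proof. by apply: prodr_ge0. Qed.

Lemma weight_sum1 M : \sum_g weight M g = 1.
Proof.
rewrite -(bigA_distr_bigA (fun i o => mu (tnth M i) o)) /=.
by apply: big1 => i _; exact: mu_sum1.
Qed.

Lemma expect_le n s f f' : (forall s, f s <= f' s) -> expect n s f <= expect n s f'.
Proof.
move=> h; elim: n s => [|n IH] s //=; case: (pending s) => [|[b M] rest] //.
by apply: ler_sum => g _; apply: ler_wpM2l; rewrite ?weight_ge0.
Qed.

Lemma expect_ge0 n s f : (forall s, 0 <= f s) -> 0 <= expect n s f.
Proof.
move=> h; elim: n s => [|n IH] s //=; case: (pending s) => [|[b M] rest] //.
by apply: sumr_ge0 => g _; rewrite mulr_ge0 ?weight_ge0.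
Qed.

Lemma expect_sum (I : finType) (Q : pred I) n s (f : I -> state -> R) :
  expect n s (fun s => \sum_(i | Q i) f i s) = \sum_(i | Q i) expect n s (f i).
Proof.
elim: n s => [|n IH] s //=; case: (pending s) => [|[b M] rest] //.
rewrite exchange_big /=; apply: eq_bigr => g _.
by rewrite IH mulr_sumr.
Qed.

Lemma expect1 n s : expect n s (fun=> 1) = 1.
Proof.
elim: n s => [|n IH] s //=; case: (pending s) => [|[b M] rest] //.
by under eq_bigr do rewrite IH mulr1; rewrite weight_sum1.
Qed.

(** Invariants of the exploration. At the end, [valid_closed] turns a chain of good blocks into a
    chain of explored ones. *)
Record valid s : Prop := Valid {
  valid_uniq : uniq (known s) ;
  valid_inside : all (inside k) (known s) ;
  valid_bad : {subset bad s <= explored s} ;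
  valid_pending : forall b M, (b, M) \in pending s -> uniq M /\ all (box b) M ;
  valid_closed : forall b b', b \in explored s -> b \notin bad s ->
    b' \in neighbours b -> inside k b' -> b' \in known s ;
  valid_origin : (0, 0)%N \in known s }.

Lemma known_cons s b M rest : pending s = (b, M) :: rest ->
  perm_eq (known s) (b :: explored s ++ map fst rest).
Proof. by rewrite /known => -> /=; rewrite perm_catC /= perm_cons perm_catC. Qed.

Lemma landingP b M g b' : good b M g -> b' \in neighbours b ->
  exists i, spread b' (tnth M i) (g i) = Some (landing M g b').
Proof.
move=> /allP/(_ b') h /h /existsP[i0 hi0]; rewrite /landing.
case: pickP => [i /= hi|/(_ i0)]; last by rewrite hi0.
by exists i; case: (spread _ _ _) hi.
Qed.

Lemma valid_explore s g : valid s -> valid (explore s g).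
Proof.
move=> vs; case ep: (pending s) => [|[b M] rest]; first by rewrite /explore ep.
have kc := known_cons ep.
have uk := valid_uniq vs; have ik := valid_inside vs.
have uk' := uk; rewrite (perm_uniq kc) in uk'.
have ik' := ik; rewrite (perm_all _ kc) in ik'.
have km : known s =i b :: explored s ++ map fst rest by apply: perm_mem.
rewrite /explore ep; case: ifP => [hg|hg]; last first.
  split=> //=.
  - by move=> b'; rewrite !inE => /orP[->//|/(valid_bad vs) ->]; rewrite orbT.
  - by move=> b' M' h; apply: (valid_pending vs); rewrite ep inE h orbT.
  - move=> b1 b2 h1 h2 h3 h4; move: h1 h2; rewrite !inE negb_or => h1 /andP[h h2].
    rewrite (negPf h) /= in h1.
    by have := valid_closed vs h1 h2 h3 h4; rewrite km.
  - by have := valid_origin vs; rewrite km.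
set D := discovered s b.
have eD : [seq x.1 | x <- [seq (b', landing M g b') | b' <- D]] = D.
  by rewrite -map_comp map_id_in.
have kn : known (State (rest ++ [seq (b', landing M g b') | b' <- D])
     (b :: explored s) (bad s)) = (b :: explored s ++ map fst rest) ++ D.
  by rewrite /known /= map_cat eD catA.
split; rewrite ?kn.
- rewrite cat_uniq uk' /= filter_uniq ?undup_uniq // andbT.
  apply/hasPn => b'; rewrite mem_filter => /andP[/andP[_ h] _].
  by rewrite -km.
- rewrite all_cat ik' /=; apply/allP => b'.
  by rewrite mem_filter => /andP[/andP[]].
- by move=> b' /(valid_bad vs) /=; rewrite inE orbC => ->.
- move=> b' M' /=; rewrite mem_cat => /orP[h|/mapP[b2 hb2 [-> ->]]].
    by apply: (valid_pending vs); rewrite ep inE h orbT.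
  move: hb2; rewrite mem_filter mem_undup => /andP[_ hb2].
  have [i /spreadP[h1 h2]] := landingP hg hb2.
  by split=> //; apply/allP => y /h2[].
- move=> b1 b2 hb1 hb1' hb2 hi2; rewrite mem_cat -km.
  move: hb1 => /=; rewrite inE => /orP[/eqP eb|h]; last by rewrite (valid_closed vs h).
  have [//|nk] := boolP (b2 \in known s).
  by rewrite mem_filter hi2 nk mem_undup -eb hb2.
- by rewrite mem_cat -km (valid_origin vs).
Qed.

Lemma pending_head s b M rest : valid s -> pending s = (b, M) :: rest ->
  [/\ b \notin explored s, uniq M & all (box b) M].
Proof.
move=> vs ep; have [|uM bM] := @valid_pending s vs b M; first by rewrite ep mem_head.
split=> //; have := valid_uniq vs; rewrite (perm_uniq (known_cons ep)) /= mem_cat.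
by rewrite negb_or => /andP[/andP[]].
Qed.

Lemma size_explore s g b M rest : pending s = (b, M) :: rest ->
  size (explored (explore s g)) = (size (explored s)).+1.
Proof. by rewrite /explore => ->; case: ifP. Qed.

(** Each step explores a new block of the window, which has [9^k] blocks; after enough steps nothing
    is pending, so [f] and [f'] need comparing on final states only. *)
Lemma expect_le_final n s f f' : valid s ->
  (3 ^ k * 3 ^ k <= n + size (explored s))%N ->
  (forall s, valid s -> pending s = [::] -> f s <= f' s) ->
  expect n s f <= expect n s f'.
Proof.
move=> vs hn h; elim: n s vs hn => [|n IH] s vs hn /=.
  apply: h => //; apply/nilP.
  have := size_inside (valid_uniq vs) (valid_inside vs).
  by rewrite size_cat size_map /nilp; move: hn; rewrite add0n; lia.
case ep: (pending s) => [|[b M] rest]; first exact: h.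
apply: ler_sum => g _; apply: ler_wpM2l; rewrite ?weight_ge0 //.
apply: IH; first exact: valid_explore.
by rewrite (size_explore _ ep) addnS.
Qed.

Variable delta : R.
Hypothesis delta_ge0 : 0 <= delta.
Hypothesis bad_le : forall b (M : m.-tuple V), uniq M -> all (box b) M ->
  \sum_(g | ~~ good b M g) weight M g <= delta.

(** The right side bounds the conditional probability given the present state: the explored blocks
    of [F] must already be bad, and every other one costs a factor [delta] when its turn comes.
    Blocks that are never explored never become bad. *)
Lemma expect_bad n s F : valid s -> uniq F ->
  expect n s (fun s => (all (mem (bad s)) F)%:R) <=
    (all (fun b => (b \in explored s) ==> (b \in bad s)) F)%:R
    * delta ^+ count (fun b => b \notin explored s) F.
Proof.
move=> vs uF.
have leaf s' F' : valid s' -> (all (mem (bad s')) F')%:R <=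
    (all (fun b => (b \in explored s') ==> (b \in bad s')) F')%:R
    * delta ^+ count (fun b => b \notin explored s') F'.
  move=> vs'; case: (boolP (all (mem (bad s')) F')) => [/allP hF|_]; last first.
    by rewrite mulr_ge0 ?exprn_ge0.
  rewrite (_ : all _ F' = true); last first.
    by apply/allP => b /hF hb; apply/implyP.
  rewrite (_ : count _ F' = 0)%N ?expr0 ?mulr1 //.
  apply/eqP; rewrite -leqn0 leqNgt -has_count; apply/hasPn => b /hF hb.
  by rewrite negbK; apply: (valid_bad vs').
elim: n s F vs uF => [|n IH] s F vs uF /=; first exact: leaf.
case ep: (pending s) => [|[b M] rest]; first exact: leaf.
have [nb hM1 hM2] := pending_head vs ep.
have ex g : explored (explore s g) = b :: explored s.
  by rewrite /explore ep; case: ifP.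
have bd g : bad (explore s g) = if good b M g then bad s else b :: bad s.
  by rewrite /explore ep; case: ifP.
have step g F' : b \notin F' -> uniq F' ->
    expect n (explore s g) (fun s => (all (mem (bad s)) F')%:R) <=
    (all (fun b => (b \in explored s) ==> (b \in bad s)) F')%:R
    * delta ^+ count (fun b => b \notin explored s) F'.
  move=> bF uF'; apply: (le_trans (IH _ _ (valid_explore g vs) uF')).
  have ne b' : b' \in F' -> (b' == b) = false.
    by move=> h; apply: contraNF bF => /eqP <-.
  rewrite le_eqVlt; apply/orP; left; apply/eqP; congr (_%:R * _ ^+ _).
    congr nat_of_bool; apply: eq_in_all => b' /ne h; rewrite ex bd inE h.
    by case: (good _ _ _); rewrite // inE h.
  by apply: eq_in_count => b' /ne h; rewrite ex inE h.
(* For [b] outside [F] the bound is the same after every outcome, and the weights sum to 1. *)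
have [bF|bF] := boolP (b \in F); last first.
  apply: (@le_trans _ _ (\sum_g weight M g *
    ((all (fun b => (b \in explored s) ==> (b \in bad s)) F)%:R
    * delta ^+ count (fun b => b \notin explored s) F))); last first.
    by rewrite -mulr_suml weight_sum1 mul1r.
  by apply: ler_sum => g _; apply: ler_wpM2l; rewrite ?weight_ge0 ?step.
have pF := perm_to_rem bF; set F' := rem b F in pF.
have uF' : uniq F' by rewrite rem_uniq.
have bF' : b \notin F' by rewrite mem_rem_uniq // !inE eqxx.
rewrite (perm_all _ pF) (seq.permP pF) /= (negPf nb) /= exprD expr1.
(* A good outcome leaves [b] explored and not bad, so its contribution vanishes. The bad outcomes
   weigh at most [delta], and [b] is then dropped from [F]. *)
set rhs := _ * _; rewrite (bigID (good b M)) /=.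
rewrite [X in X + _]big1 ?add0r; last first.
  move=> g hg; apply/eqP; rewrite mulf_eq0; apply/orP; right.
  rewrite eq_le expect_ge0 // andbT.
  apply: (le_trans (IH _ _ (valid_explore g vs) uF)).
  rewrite (_ : all _ F = false) ?mul0r //; apply/negbTE/allPn; exists b => //.
  rewrite ex bd hg mem_head /=; apply: contra nb; exact: valid_bad.
have -> : rhs = delta *
   ((all (fun b => (b \in explored s) ==> (b \in bad s)) F')%:R
    * delta ^+ count (fun b => b \notin explored s) F').
  by rewrite mulrCA.
apply: (@le_trans _ _ (\sum_(g | ~~ good b M g) weight M g *
   ((all (fun b => (b \in explored s) ==> (b \in bad s)) F')%:R
    * delta ^+ count (fun b => b \notin explored s) F'))).
  apply: ler_sum => g _; apply: ler_wpM2l; rewrite ?weight_ge0 //.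
  apply: le_trans (step g F' bF' uF'); apply: expect_le => s'.
  by rewrite (perm_all _ pF) /= ler_nat; case: (_ \in _) => //=; case: all.
rewrite -mulr_suml; apply: ler_wpM2r; last exact: bad_le.
by rewrite mulr_ge0 ?exprn_ge0.
Qed.

(** Blocks outside the window count as closed, so that chains of open blocks stay inside it. *)
Definition closed_blocks s : pred block := [pred b | ~~ inside k b || (b \in bad s)].

Lemma explored_connected s b b' : valid s -> pending s = [::] ->
  block_connected (closed_blocks s) b b' -> ~~ closed_blocks s b ->
  b \in explored s -> b' \in explored s.
Proof.
move=> vs ps h hb eb; have ek : known s = explored s by rewrite /known ps cats0.
elim: h hb eb => // b0 b1 b2 h IH hn h2 h0 e0.
have e1 := IH h0 e0; have := linked_blocks_open h h0.
rewrite /closed_blocks /= negb_or negbK => /andP[i1 n1].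
move: h2; rewrite /closed_blocks /= negb_or negbK => /andP[i2 _].
by rewrite -ek; apply: (valid_closed vs) hn i2.
Qed.

(** With nothing explored yet, [expect_bad] is exactly the domination by [delta]. A good lineage of
    the origin yields a good block with first coordinate at least [k], connected to the origin and
    hence explored. *)
Lemma expect_far s : valid s -> explored s = [::] ->
  81%:R * delta <= 4%:R^-1 ->
  2%:R^-1 <= expect (3 ^ k * 3 ^ k) s
    (fun s => (has (fun b : block => k <= b.1)%N (explored s))%:R).
Proof.
move=> vs es hd; set n := (_ * _)%N.
pose E (f : pred block -> R) := expect n s (fun s => f (closed_blocks s)).
have Emono f f' : (forall X, f X <= f' X) -> E f <= E f'.
  by move=> h; apply: expect_le => s'.
have Esum (I : finType) (Q : pred I) (f : I -> pred block -> R) :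
    E (fun X => \sum_(i | Q i) f i X) = \sum_(i | Q i) E (f i).
  exact: expect_sum.
have dom : dominated E id k delta.
  move=> J uJ iJ; rewrite /E.
  apply: (@le_trans _ _ (expect n s (fun s => (all (mem (bad s)) J)%:R))).
    apply: expect_le => s'; rewrite le_eqVlt; apply/orP; left; apply/eqP.
    congr (_%:R); congr nat_of_bool; apply: eq_in_all => b /(allP iJ).
    by rewrite /closed_blocks /= => ->.
  apply: (le_trans (expect_bad n vs uJ)).
  rewrite es (eq_count (a2 := predT)) // count_predT.
  by rewrite (eq_all (a2 := predT)) // all_predT mul1r.
apply: le_trans (dominated_lineage Emono Esum delta_ge0 hd (expect1 n s) dom) _.
apply: expect_le_final => //; first by rewrite es addn0.
move=> s' vs' ps'; rewrite ler_nat.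
case: (boolP (lineage_open _ _ _)) => // h.
have [b [hb ib kb]] := lineage_far h.
have c : block_connected (closed_blocks s') (0, 0)%N b.
  by apply: lineage_connected h hb _; rewrite ib iter_parent0.
have eb : b \in explored s'.
  apply: explored_connected c (lineage_open0 h) _ => //.
  by have := valid_origin vs'; rewrite /known ps' cats0.
by rewrite lt0b; apply/hasP; exists b.
Qed.

(** * From the abstract exploration to histories of revealed outcomes *)

Inductive active (root : V) (h : seq (V * O)) : V -> Prop :=
| active_root : active root h root
| active_visit x o y : active root h x -> (x, o) \in h -> visits x o y ->
    active root h y.

Lemma active_cat root h h' x : active root h x -> active root (h ++ h') x.
Proof.
elim=> {x} [|x o y _ IH hx hy]; first exact: active_root.
by apply: active_visit IH _ hy; rewrite mem_cat hx.
Qed.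

Definition extend (h : seq (V * O)) (M : m.-tuple V) (g : outcomes) :=
  h ++ [seq (tnth M i, g i) | i <- enum 'I_m].

Lemma keys_extend h M g : map fst (extend h M g) = map fst h ++ M.
Proof.
rewrite /extend map_cat -map_comp; congr (_ ++ _).
by rewrite -[RHS]map_tnth_enum; apply: eq_map.
Qed.

Hypothesis m_gt0 : (0 < m)%N.
(* [pi h] and [alpha h] stand for the probabilities of the history [h], and of
   its intersection with the event to be bounded from below. *)
Variables (pi alpha : seq (V * O) -> R) (root : V).
Hypothesis pi_ge0 : forall h, 0 <= pi h.
Hypothesis alpha_ge0 : forall h, 0 <= alpha h.
Hypothesis pi_extend : forall h (M : m.-tuple V) g, uniq (map fst h ++ M) ->
  pi (extend h M g) = pi h * weight M g.
Hypothesis alpha_extend : forall h (M : m.-tuple V), uniq (map fst h ++ M) ->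
  \sum_g alpha (extend h M g) <= alpha h.
Hypothesis alpha_far : forall h b x, uniq (map fst h) -> (k <= b.1)%N ->
  box b x -> active root h x -> pi h <= alpha h.

(** Induction on the exploration, the history [h] growing with it. Revealed sites meet only the
    boxes of explored blocks, pending sites are active, and each explored block contains an active
    site; a far explored block thus gives a far active site. *)
Lemma alpha_expect n s h : valid s -> uniq (map fst h) ->
  (forall x b, x \in map fst h -> box b x -> b \in explored s) ->
  (forall b M x, (b, M) \in pending s -> x \in M -> active root h x) ->
  (forall b, b \in explored s -> exists2 x, box b x & active root h x) ->
  pi h * expect n s (fun s => (has (fun b : block => k <= b.1)%N (explored s))%:R)
  <= alpha h.
Proof.
have leaf s' h' : uniq (map fst h') ->
  (forall b, b \in explored s' -> exists2 x, box b x & active root h' x) ->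
  pi h' * (has (fun b : block => k <= b.1)%N (explored s'))%:R <= alpha h'.
  move=> uh hx; case: (boolP (has _ _)) => [/hasP[b hb kb]|_].
    by have [x bx ax] := hx b hb; rewrite mulr1 (alpha_far uh kb bx ax).
  by rewrite mulr0 alpha_ge0.
elim: n s h => [|n IH] s h vs uh keys pact eact /=; first exact: leaf.
case ep: (pending s) => [|[b M] rest]; first exact: leaf.
have [nb uM /allP bM] := pending_head vs ep.
(* A pending block is not explored, so no outcome of its sites has been revealed: the factorisation
   over [h] and [M] applies. *)
have uhM : uniq (map fst h ++ M).
  rewrite cat_uniq uh uM andbT; apply/hasPn => x xM; apply: contra nb => xh.
  exact: keys xh (bM x xM).
apply: le_trans (alpha_extend uhM); rewrite mulr_sumr; apply: ler_sum => g _.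
rewrite mulrA -pi_extend //.
have ex : explored (explore s g) = b :: explored s.
  by rewrite /explore ep; case: ifP.
have Mact x : x \in M -> active root h x.
  by apply: (pact b M); rewrite ep mem_head.
apply: IH; first exact: valid_explore.
- by rewrite keys_extend.
- move=> x b'; rewrite keys_extend mem_cat ex inE => /orP[xh|xM] bx.
    by rewrite (keys _ _ xh bx) orbT.
  by rewrite (box_inj bx (bM x xM)) eqxx.
- move=> b' M' x; rewrite /explore ep.
  have old : (b', M') \in rest -> x \in M' -> active root (extend h M g) x.
    by move=> hr xM; apply/active_cat/(pact b' M') => //; rewrite ep inE hr orbT.
  case: ifP => [hg /=|_ /=]; last exact: old.
  rewrite mem_cat => /orP[|/mapP[b2 hb2 [_ ->]]]; first exact: old.
  move: hb2; rewrite mem_filter mem_undup => /andP[_ hb2] xl.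
  have [i /spreadP[_ /(_ x xl)[_ hv]]] := landingP hg hb2.
  apply: active_visit (active_cat _ (Mact _ (mem_tnth i M))) _ hv.
  by rewrite mem_cat; apply/orP; right; apply/mapP; exists i; rewrite ?mem_enum.
- move=> b'; rewrite ex inE => /orP[/eqP->|/eact[x bx ax]]; last first.
    by exists x => //; exact: active_cat.
  exists (tnth M (Ordinal m_gt0)); first by apply: bM; exact: mem_tnth.
  by apply/active_cat/Mact; exact: mem_tnth.
Qed.

(** The exploration starts from the single pending block [(0, 0)]; the sites of [h] lie in no box,
    so everything in the boxes is still fresh. *)
Lemma half_le_alpha h (M : m.-tuple V) : 81%:R * delta <= 4%:R^-1 ->
  uniq (map fst h) -> uniq M -> all (box (0, 0)%N) M ->
  (forall x b, x \in map fst h -> ~~ box b x) ->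
  (forall x, x \in M -> active root h x) ->
  pi h / 2%:R <= alpha h.
Proof.
move=> hd uh uM bM keys Mact.
pose s := State [:: ((0, 0)%N, M)] [::] [::].
have vs : valid s.
  split=> //=; first by rewrite /inside /= !expn_gt0.
  by move=> b M'; rewrite inE => /eqP[-> ->].
apply: le_trans _ (@alpha_expect (3 ^ k * 3 ^ k)%N s h vs uh _ _ _) => //.
- by rewrite ler_wpM2l // expect_far.
- move=> x b xh bx. by move: (keys x b xh); rewrite bx.
- by move=> b M' x; rewrite inE => /eqP[_ ->]; exact: Mact.
Qed.

End Exploration.

(** The [m] independent particles all miss a given neighbour with probability at most
    [(1 - kappa)^m]; the factor 4 counts the neighbours. *)
Lemma bad_weight_le (R : realFieldType) (V : eqType) (O : finType)
  (mu : V -> O -> R) (m : nat) (box : block -> pred V)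
  (spread : block -> V -> O -> option (m.-tuple V)) (kappa : R)
  (mu_ge0 : forall x o, 0 <= mu x o) (mu_sum1 : forall x, \sum_o mu x o = 1)
  (hk : forall b b' x, b' \in neighbours b -> box b x ->
    kappa <= \sum_(o | spread b' x o) mu x o)
  (b : block) (M : m.-tuple V) : kappa <= 1 -> all (box b) M ->
  \sum_(g | ~~ good spread b M g) weight mu M g <= 4%:R * (1 - kappa) ^+ m.
Proof.
move=> k1 /allP bM.
pose miss b' (g : {ffun 'I_m -> O}) := [forall i, ~~ spread b' (tnth M i) (g i)].
have hb b' : b' \in neighbours b ->
  \sum_(g | miss b' g) weight mu M g <= (1 - kappa) ^+ m.
  move=> hb'; rewrite (eq_bigl (mem (family (fun i o => ~~ spread b' (tnth M i) o)))) //.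
  rewrite -(bigA_distr_big_dep _ (fun i o => mu (tnth M i) o)) /=.
  rewrite -[m in leRHS]card_ord -prodr_const; apply: ler_prod => i _.
  rewrite sumr_ge0 //= -(mu_sum1 (tnth M i)).
  rewrite [X in _ <= X - _](bigID (fun o => spread b' (tnth M i) o : bool)) /=.
  have := hk _ _ _ hb' (bM _ (mem_tnth i M)); set y := \sum_(_ | _) _; lra.
apply: (@le_trans _ _ (\sum_(b' <- neighbours b) \sum_(g | miss b' g) weight mu M g)).
  under [leRHS]eq_bigr do rewrite big_mkcond.
  rewrite exchange_big /= big_mkcond; apply: ler_sum => g _.
  have w0 := weight_ge0 mu_ge0 M g.
  case: ifP => [/allPn[b' hb' /existsPn hg]|_]; last first.
    by apply: sumr_ge0 => b' _; case: ifP.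
  have hm : miss b' g by apply/forallP.
  rewrite (big_rem b') //= hm lerDl.
  by apply: sumr_ge0 => b2 _; case: ifP.
apply: (@le_trans _ _ (\sum_(b' <- neighbours b) (1 - kappa) ^+ m)).
  by rewrite big_seq [leRHS]big_seq; apply: ler_sum => b' /hb.
by rewrite !big_cons big_nil; lra.
Qed.

(** * Hitting probabilities of the walk *)

(** With [e = 1/M], [(1 - e)(1 + e) <= 1] while Bernoulli's inequality gives [(1 + e)^M >= 2]. *)
Lemma power_half (R : realFieldType) (M : nat) : (0 < M)%N ->
  (1 - M%:R^-1 : R) ^+ M <= 2%:R^-1.
Proof.
move=> M0; have M1 : 0 < (M%:R : R) by rewrite ltr0n.
set e : R := M%:R^-1; set c := 1 - e.
have e0 : 0 <= e by rewrite invr_ge0 ltW.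
have c0 : 0 <= c by rewrite subr_ge0 invf_le1 // ler1n.
have h1 : c * (1 + e) <= 1 by rewrite /c; nra.
have h2 : c ^+ M * (1 + e) ^+ M <= 1.
  by rewrite -exprMn exprn_ile1 // mulr_ge0 // addr_ge0.
have bern n : 1 + n%:R * e <= (1 + e) ^+ n.
  elim: n => [|n IH]; first by rewrite mul0r addr0 expr0.
  rewrite exprS; apply: le_trans (ler_wpM2l _ IH); last by rewrite addr_ge0.
  have : 0 <= (n%:R : R) * e * e by rewrite !mulr_ge0.
  rewrite -natr1; lra.
have h3 : 2%:R <= (1 + e) ^+ M.
  by apply: le_trans (bern M); rewrite divff ?gt_eqF // -natrD.
have := exprn_ge0 M c0; move: h2 h3; set y := c ^+ M; set z := _ ^+ M; nra.
Qed.

Lemma compl_half (R : realFieldType) (h c : R) :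
  1 - h <= c -> c <= 2%:R^-1 -> 2%:R^-1 <= h.
Proof. lra. Qed.

(** * Probabilities under uniform words of steps *)

Section Average.
Variables (R : realFieldType) (St : finType).
Hypothesis St_gt0 : (0 < #|St|)%N.

(** Probability of [Q] for a uniform word of length [n]; the recursion on the first letter is
    first-step analysis. *)
Fixpoint average n (Q : pred (seq St)) : R :=
  if n is n'.+1 then #|St|%:R^-1 * \sum_s average n' (fun t => Q (s :: t))
  else (Q [::])%:R.

Local Notation N := (#|St|%:R : R).

Lemma N_gt0 : 0 < N. Proof. by rewrite ltr0n. Qed.
Lemma N_neq0 : N != 0. Proof. by rewrite gt_eqF ?N_gt0. Qed.

Lemma mean_cst (c : R) : N^-1 * \sum_(s : St) c = c.
Proof. by rewrite sumr_const -[c *+ _]mulr_natl mulrA mulVf ?mul1r ?N_neq0. Qed.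

Lemma mean_le (f g : St -> R) : (forall s, f s <= g s) ->
  N^-1 * \sum_s f s <= N^-1 * \sum_s g s.
Proof.
by move=> h; rewrite ler_wpM2l ?invr_ge0 ?ler0n //; apply: ler_sum => s _.
Qed.

Lemma average_le n (Q Q' : pred (seq St)) : (forall t, Q t -> Q' t) ->
  average n Q <= average n Q'.
Proof.
elim: n Q Q' => [|n IH] Q Q' h /=.
  by rewrite ler_nat; case: (Q _) (h [::]) => // ->.
by apply: mean_le => s; apply: IH => t; exact: h.
Qed.

Lemma eq_average n (Q Q' : pred (seq St)) : Q =1 Q' -> average n Q = average n Q'.
Proof. by move=> h; apply/eqP; rewrite eq_le !average_le // => t; rewrite h. Qed.

Lemma average_predT n : average n predT = 1.
Proof.
elim: n => //= n IH; rewrite -[RHS](mean_cst 1); congr (_ * _).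
by apply: eq_bigr => s _; rewrite -[RHS]IH; exact: eq_average.
Qed.

Lemma average_ge0 n (Q : pred (seq St)) : 0 <= average n Q.
Proof.
elim: n Q => [|n IH] Q /=; first exact: ler0n.
by rewrite mulr_ge0 ?invr_ge0 ?ler0n // sumr_ge0.
Qed.

Lemma average_has (I : eqType) n (r : seq I) (Q : I -> pred (seq St)) :
  average n (fun t => has (fun i => Q i t) r) <= \sum_(i <- r) average n (Q i).
Proof.
elim: n Q => [|n IH] Q /=.
  elim: r => [|i r IHr] /=; first by rewrite big_nil.
  rewrite big_cons; apply: le_trans (lerD (lexx _) IHr).
  by rewrite -natrD ler_nat; case: (Q i _) => /=; case: has.
rewrite -mulr_sumr exchange_big /=.
by apply: mean_le => s; exact: IH.
Qed.

Lemma average_rcons n (Q : pred (seq St)) : (forall t s, Q t -> Q (rcons t s)) ->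
  average n Q <= average n.+1 Q.
Proof.
elim: n Q => [|n IH] Q h /=.
  rewrite -[leLHS]mean_cst; apply: mean_le => s.
  by rewrite ler_nat; case: (Q [::]) (h [::] s) => // ->.
by apply: mean_le => s; apply: IH => t s'; rewrite -rcons_cons; exact: h.
Qed.

Lemma average_mono n n' (Q : pred (seq St)) : (forall t s, Q t -> Q (rcons t s)) ->
  (n <= n')%N -> average n Q <= average n' Q.
Proof.
move=> h /subnK <-; elim: (n' - n)%N => // k IH.
by rewrite addSn; apply: le_trans IH (average_rcons _ h).
Qed.

Lemma average_tuple n (Q : pred (seq St)) :
  average n Q = \sum_(t : n.-tuple St | Q t) N^-1 ^+ n.
Proof.
elim: n Q => [|n IH] Q /=.
  rewrite expr0 big_mkcond (big_pred1 [tuple]) /=; last first.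
    by move=> t; rewrite [t]tuple0 /= eqxx.
  by case: (Q [::]).
rewrite exprS [RHS]big_mkcond /=.
rewrite (reindex (fun p : St * n.-tuple St => [tuple of p.1 :: p.2])) /=; last first.
  exists (fun t : n.+1.-tuple St => (thead t, [tuple of behead t])) => [[s t] _|t _].
    by rewrite theadE; congr (_, _); apply: val_inj.
  by rewrite [RHS]tuple_eta; apply: val_inj.
rewrite -(pair_big predT predT (fun s (t : n.-tuple St) =>
  if Q (s :: t) then N^-1 * N^-1 ^+ n else 0)) /= mulr_sumr.
apply: eq_bigr => s _; rewrite IH mulr_sumr [LHS]big_mkcond /=.
by apply: eq_bigr => t _; case: (Q _); rewrite ?mulr0.
Qed.

End Average.

Section Hitting.
Variables (R : realFieldType) (St : finType) (V : eqType) (move : V -> St -> V).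
Hypothesis St_gt0 : (0 < #|St|)%N.

Definition trajectory x (t : seq St) := x :: scanl move x t.

Definition hits (T : pred V) x t := has T (trajectory x t).

Local Notation average := (@average R St).
Local Notation N := (#|St|%:R : R).

Lemma trajectory_rcons x t s :
  trajectory x (rcons t s) = rcons (trajectory x t) (foldl move x (rcons t s)).
Proof. by rewrite /trajectory scanl_rcons. Qed.

Lemma trajectory_cons x s t : trajectory x (s :: t) = x :: trajectory (move x s) t.
Proof. by []. Qed.

Lemma hits_rcons T x t s : hits T x t -> hits T x (rcons t s).
Proof. by rewrite /hits trajectory_rcons has_rcons => ->; rewrite orbT. Qed.

Definition hit n T x := average n (hits T x).

Lemma hit_now n (T : pred V) x : T x -> hit n T x = 1.
Proof.
move=> h; rewrite -(average_predT R St_gt0 n); apply: eq_average => // t.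
by rewrite /hits /trajectory /= h.
Qed.

Lemma hitS n (T : pred V) x : ~~ T x ->
  hit n.+1 T x = N^-1 * \sum_s hit n T (move x s).
Proof.
move=> h /=; congr (_ * _); apply: eq_bigr => s _; apply: eq_average => // t.
by rewrite /hits trajectory_cons /= (negPf h).
Qed.

Lemma hit_ge0 n T x : 0 <= hit n T x. Proof. exact: average_ge0. Qed.

Lemma hit_mono n n' T x : (n <= n')%N -> hit n T x <= hit n' T x.
Proof. by apply: average_mono => // t s; exact: hits_rcons. Qed.

Lemma hit_sub n (T T' : pred V) x : (forall y, T y -> T' y) -> hit n T x <= hit n T' x.
Proof. by move=> h; apply: average_le => // t; exact: sub_has. Qed.

(* The strong Markov property at the hitting time of [T]. *)
Lemma average_after_hit n1 n2 (T : pred V) (Q : V -> pred (seq St)) c x :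
  (forall x t s, Q x t -> Q x (rcons t s)) ->
  (forall x s t, Q (move x s) t -> Q x (s :: t)) ->
  0 <= c -> (forall y, T y -> c <= average n2 (Q y)) ->
  c * hit n1 T x <= average (n1 + n2) (Q x).
Proof.
move=> Qr Ql c0 hT; elim: n1 x => [|n1 IH] x.
  rewrite add0n /hit /= /hits /trajectory /= orbF.
  by case: (boolP (T x)) => [/hT h|_]; rewrite ?mulr1 // mulr0 average_ge0.
have [Tx|nTx] := boolP (T x).
  rewrite hit_now // mulr1; apply: (le_trans (hT x Tx)).
  by apply: average_mono; [|exact: Qr|rewrite leq_addl].
rewrite hitS // addSn /= mulrCA mulr_sumr; apply: mean_le => // s.
apply: (le_trans (IH _)); apply: average_le => // t; exact: Ql.
Qed.

Lemma hit_after_hit n1 n2 (T T' : pred V) c x : 0 <= c ->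
  (forall y, T y -> c <= hit n2 T' y) -> c * hit n1 T x <= hit (n1 + n2) T' x.
Proof.
move=> c0 h; apply: average_after_hit => //.
- by move=> *; exact: hits_rcons.
- by move=> y s t; rewrite /hits trajectory_cons /= => ->; rewrite orbT.
Qed.

(** Having missed [T] for [n1] steps, the walk restarts and misses it again with probability at most
    [c], wherever it stands. *)
Lemma miss_after_miss n1 n2 (T : pred V) c x : 0 <= c ->
  (forall y, 1 - hit n2 T y <= c) ->
  1 - hit (n1 + n2) T x <= c * (1 - hit n1 T x).
Proof.
move=> c0 h; elim: n1 x => [|n1 IH] x.
  have [Tx|nTx] := boolP (T x); first by rewrite !hit_now // subrr mulr0.
  have -> : hit 0 T x = 0 by rewrite /hit /= /hits /trajectory /= (negPf nTx).
  by rewrite subr0 mulr1; exact: h.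
have [Tx|nTx] := boolP (T x); first by rewrite !hit_now // subrr mulr0.
have compl f : 1 - N^-1 * \sum_(s : St) f s = N^-1 * \sum_s (1 - f s).
  by rewrite sumrB mulrBr mean_cst.
rewrite addSn !hitS // !compl mulrCA [c * _]mulr_sumr.
by apply: mean_le => // s; exact: IH.
Qed.

(** Discrete intermediate value theorem: [f] gains at most one per step, so no level is jumped over
    on the way up. *)
Lemma hits_level (f : V -> nat) j (T : pred V) x t : (forall x s, (f (move x s) <= (f x).+1)%N) ->
  (f x <= j)%N -> (forall y, T y -> (j <= f y)%N) -> hits T x t ->
  hits (fun y => f y == j) x t.
Proof.
move=> fs + hT; elim: t x => [|s t IH] x.
  by rewrite /hits /= !orbF eqn_leq => -> /hT ->.
rewrite leq_eqVlt => /orP[/eqP fx|fx]; first by rewrite /hits /= fx eqxx.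
rewrite /hits !trajectory_cons /= => /orP[/hT|h].
  by rewrite leqNgt fx.
by apply/orP; right; apply: IH h; exact: leq_trans (fs _ _) fx.
Qed.

End Hitting.

(** An injective relabelling of the finite set of steps preserves the uniform law. This serves both
    for the symmetries of the plane and for the projection. *)
Lemma hit_morph (R : realFieldType) (St : finType) (V V' : eqType)
    (move : V -> St -> V) (move' : V' -> St -> V') n (T : pred V')
    (phi : V -> V') (sigma : St -> St) x : (0 < #|St|)%N ->
  injective sigma -> (forall x s, phi (move x s) = move' (phi x) (sigma s)) ->
  hit R move' n T (phi x) = hit R move n (T \o phi) x.
Proof.
move=> St_gt0 si h; elim: n x => [|n IH] x; first by [].
have [Tx|nTx] := boolP (T (phi x)); first by rewrite !hit_now.
rewrite !hitS //; congr (_ * _); rewrite (reindex_inj si) /=.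
by apply: eq_bigr => s _; rewrite -h IH.
Qed.

(** * The planar projection of the walk, its symmetries and its exits from squares *)

Section PlaneWalk.
Variables (R : realFieldType) (d : nat) (i0 i1 : 'I_d).
Hypothesis i01 : i0 != i1.

Local Notation St := ('I_d * bool)%type.
Local Notation plane := (int * int)%type.

(** Steps along the other coordinates leave the projection in place: this is a lazy planar walk. *)
Definition plane_move (z : plane) (s : St) : plane :=
  if s.1 == i0 then (z.1 + (-1) ^+ s.2, z.2)
  else if s.1 == i1 then (z.1, z.2 + (-1) ^+ s.2) else z.

Local Notation plane_hit := (@hit R St plane plane_move).

Lemma St_gt0 : (0 < #|{: St}|)%N.
Proof. by apply/card_gt0P; exists (i0, true). Qed.

Definition radius (z : plane) := maxn `|z.1|%N `|z.2|%N.

Lemma radius_move (c z : plane) s :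
  (radius (plane_move z s - c)%R <= (radius (z - c)%R).+1)%N.
Proof.
case: c z => c0 c1 [a b]; rewrite /radius /plane_move.
by case: s => i [] /=; case: eqP => _ /=; try case: eqP => _ /=; lia.
Qed.

Lemma hit_translate n (T : pred plane) c z :
  plane_hit n T (z + c) = plane_hit n (fun y => T (y + c)) z.
Proof.
apply: (@hit_morph R St _ _ _ _ n T (fun y => y + c) id _ St_gt0) => // -[a b] s.
rewrite /plane_move /=; case: eqP => _ /=; try case: eqP => _ //=;
by congr (_, _); rewrite /= addrAC.
Qed.

Definition flip (f0 f1 : bool) (z : plane) : plane :=
  ((-1) ^+ f0 * z.1, (-1) ^+ f1 * z.2).

Lemma hit_flip n T f0 f1 z : plane_hit n T (flip f0 f1 z) = plane_hit n (T \o flip f0 f1) z.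
Proof.
pose sg (s : St) : St :=
  (s.1, if s.1 == i0 then s.2 (+) f0 else if s.1 == i1 then s.2 (+) f1 else s.2).
apply: (@hit_morph R St _ _ _ _ n T (flip f0 f1) sg _ St_gt0).
  move=> [i b] [j b'] [-> /=].
  case: eqP => _; first by move/addIb ->.
  by case: eqP => _; [move/addIb ->|move=> ->].
move=> [a b] [i s]; rewrite /plane_move /flip /sg /=.
case: eqP => _ /=; last case: eqP => _ //=; congr (_, _) => //.
- by rewrite mulrDr signr_addb [_ * (-1) ^+ f0]mulrC.
- by rewrite mulrDr signr_addb [_ * (-1) ^+ f1]mulrC.
Qed.

Definition swap (z : plane) : plane := (z.2, z.1).

Lemma hit_swap n T z : plane_hit n T (swap z) = plane_hit n (T \o swap) z.
Proof.
apply: (@hit_morph R St _ _ _ _ n T swap (fun s => (tperm i0 i1 s.1, s.2)) _ St_gt0).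
  by move=> [i b] [j b'] [/perm_inj -> ->].
move=> [a b] [i s]; rewrite /plane_move /swap /=.
have [->|ni0] := eqVneq i i0; first by rewrite tpermL eq_sym (negPf i01) eqxx.
have [->|ni1] := eqVneq i i1; first by rewrite tpermR eqxx.
by rewrite tpermD 1?[_ == i]eq_sym // (negPf ni0) (negPf ni1).
Qed.

Local Notation N := (#|{: St}|%:R : R).

(** The walk may make [k] steps forward in the first direction, each with probability [1/N]. *)
Lemma hit_straight (r k : nat) (z : plane) : r%:Z - k%:Z <= z.1 ->
  N^-1 ^+ k <= plane_hit k (fun y => (r <= radius y)%N) z.
Proof.
have now z' : (r <= radius z')%N -> forall k,
    N^-1 ^+ k <= plane_hit k (fun y => (r <= radius y)%N) z'.
  move=> h k'; rewrite hit_now //; last exact: St_gt0.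
  by rewrite exprn_ile1 ?invr_ge0 ?ler0n // invf_le1 ?ltr0n ?ler1n ?St_gt0.
elim: k z => [|k IH] z hz; first by apply: now; rewrite /radius; lia.
have [h|h] := boolP (r <= radius z)%N; first exact: now.
rewrite hitS //.
rewrite exprS ler_wpM2l ?invr_ge0 ?ler0n //.
rewrite (bigD1 (i0, false)) //=; apply: le_trans (IH (plane_move z (i0, false)) _) _.
  by rewrite /plane_move /= eqxx /= expr0; lia.
by rewrite lerDl sumr_ge0 // => s _; exact: hit_ge0.
Qed.

Lemma exit_half (r : nat) : exists n,
  2%:R^-1 <= plane_hit n (fun y => (r <= radius y)%N) (0 : plane).
Proof.
set T : pred plane := fun y => (r <= radius y)%N; set K := (2 * r)%N; pose M := (#|{: St}| ^ K)%N.
have M0 : (0 < M)%N by rewrite expn_gt0 St_gt0.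
have M1 : 0 < (M%:R : R) by rewrite ltr0n.
set c : R := 1 - M%:R^-1.
have c0 : 0 <= c by rewrite subr_ge0 invf_le1 // ler1n.
(* Left of [-r] the walk is already out; elsewhere [2 r] straight steps suffice, with probability at
   least [1/M]. Repeating this [M] times fails with probability at most one half. *)
have hK z : 1 - plane_hit K T z <= c.
  case: z => a b; rewrite lerD2l lerN2 natrX -exprVn.
  have [h|h] := boolP (- r%:Z <= a).
    by apply: hit_straight; rewrite /K /=; lia.
  rewrite (hit_now _ _ St_gt0); last by rewrite /T /radius /=; lia.
  by rewrite exprn_ile1 ?invr_ge0 ?ler0n // invf_le1 ?ltr0n ?ler1n ?St_gt0.
have hj j z : 1 - plane_hit (j * K) T z <= c ^+ j.
  elim: j z => [|j IH] z; first by rewrite expr0 lerBlDr lerDl hit_ge0.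
  rewrite mulSn exprSr.
  apply: (le_trans (miss_after_miss St_gt0 K _ _ IH)); first exact: exprn_ge0.
  by rewrite ler_wpM2l ?exprn_ge0.
exists (M * K)%N.
exact: compl_half (hj M 0) (power_half R M0).
Qed.

(** One of the eight half sides of the square of radius [r]; the others are its images under [flip]
    and [swap]. *)
Definition half_side (r : nat) (z : plane) := (z.1 == r%:Z) && (0 <= z.2 <= r%:Z).

(* By symmetry the eight half sides of the square are hit with equal
   probabilities, whose sum is at least 1/2. *)
Lemma exit_half_side (r : nat) : exists n, forall f0 f1 sw (z : plane),
  16%:R^-1 <= plane_hit n (fun y => half_side r
    (flip f0 f1 (if sw : bool then swap (y - z) else y - z))) z.
Proof.
have [n hn] := exit_half r; exists n.
set T := half_side r.
pose sym (g : bool * bool * bool) (y : plane) :=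
  flip g.1.1 g.1.2 (if g.2 then swap y else y).
have flip0 f0 f1 : flip f0 f1 0 = 0 by rewrite /flip /= !mulr0.
have hsym g : plane_hit n (fun y => T (sym g y)) 0 = plane_hit n T 0.
  case: g => -[f0 f1] []; rewrite /sym /=.
    rewrite -[RHS](congr1 _ (flip0 f0 f1)) hit_flip.
    by rewrite -[0 in RHS]/(swap 0) hit_swap.
  by rewrite -[0 in RHS](flip0 f0 f1) hit_flip.
have hT : plane_hit n T 0 >= 16%:R^-1.
  suff : 2%:R^-1 <= \sum_(g <- enum [set: bool * bool * bool]) plane_hit n (fun y => T (sym g y)) 0.
    rewrite (eq_bigr (fun=> plane_hit n T 0)) => [|g _]; last exact: hsym.
    rewrite big_enum sumr_const cardsT !card_prod card_bool -mulr_natr; lra.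
  apply: le_trans hn (le_trans _ (average_has _ n _ _)).
  apply: average_le.
  move=> t ht.
  (* The radius grows by at most one per step, so the square is left through a point at radius
     exactly [r], which lies on some half side. *)
  have := @hits_level _ _ plane_move radius r _ 0 t _ _ _ ht.
  have rs (x : plane) (s : St) : (radius (plane_move x s) <= (radius x).+1)%N.
    by have := radius_move 0 x s; rewrite !subr0.
  move=> /(_ rs isT (fun _ h => h)) /hasP[y yt /eqP ry].
  have [g hg] : exists g, T (sym g y).
    case: y {yt} ry => a b; rewrite /radius /= => ry.
    have [e|ne] := eqVneq `|a|%N r.
      exists (a < 0, b < 0, false); rewrite /T /half_side /sym /flip /=.
      by case: (ltP a 0) => h1; case: (ltP b 0) => h2; rewrite /= ?expr0 ?expr1; lia.
    exists (b < 0, a < 0, true); rewrite /T /half_side /sym /flip /=.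
    by case: (ltP a 0) => h1; case: (ltP b 0) => h2; rewrite /= ?expr0 ?expr1; lia.
  by apply/hasP; exists g; [rewrite mem_enum inE|apply/hasP; exists y].
move=> f0 f1 sw z; rewrite -[z in X in _ <= X]add0r hit_translate.
apply: (le_trans hT); rewrite -(hsym (f0, f1, sw)).
by apply: hit_sub => y; rewrite add0r addrK.
Qed.

Definition exits_half_sides r n := forall f0 f1 sw (z : plane),
  16%:R^-1 <= plane_hit n (fun y => half_side r
    (flip f0 f1 (if sw : bool then swap (y - z) else y - z))) z.

(** The half side is chosen by the signs of the coordinates: [|z.1|] drops by exactly [r], and [z.2]
    moves towards 0 by at most [r], possibly across it. *)
Lemma steer_fst r n n2 (T : pred plane) c z : exits_half_sides r n -> 0 <= c ->
  (r <= `|z.1|)%N ->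
  (forall y : plane, `|y.1|%N = (`|z.1| - r)%N ->
     (`|y.2| <= maxn `|z.2| r)%N -> c <= plane_hit n2 T y) ->
  c / 16%:R <= plane_hit (n + n2) T z.
Proof.
move=> hn c0 rz hT; have h := hn (0 < z.1) (0 < z.2) false z.
apply: le_trans (ler_wpM2l c0 h) (hit_after_hit St_gt0 n z c0 _).
case: z rz hT {h} => a b rz hT [a' b'] /andP[].
rewrite /= => h1 h2; apply: hT => /=; move: h1 h2 rz => /=;
by case: (ltP 0 a); case: (ltP 0 b); rewrite ?expr0 ?expr1; lia.
Qed.

Lemma steer_snd r n n2 (T : pred plane) c z : exits_half_sides r n -> 0 <= c ->
  (r <= `|z.2|)%N ->
  (forall y : plane, `|y.2|%N = (`|z.2| - r)%N ->
     (`|y.1| <= maxn `|z.1| r)%N -> c <= plane_hit n2 T y) ->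
  c / 16%:R <= plane_hit (n + n2) T z.
Proof.
move=> hn c0 rz hT; have h := hn (0 < z.2) (0 < z.1) true z.
apply: le_trans (ler_wpM2l c0 h) (hit_after_hit St_gt0 n z c0 _).
case: z rz hT {h} => a b rz hT [a' b'] /andP[].
rewrite /= => h1 h2; apply: hT => /=; move: h1 h2 rz => /=;
by case: (ltP 0 a); case: (ltP 0 b); rewrite ?expr0 ?expr1; lia.
Qed.

(** The first coordinate is reduced in [k] exits, then the second in [l]; meanwhile the other one
    never leaves its allowed range. *)
Lemma steer r n k l (z : plane) : exits_half_sides r n ->
  (`|z.1| <= k.+1 * r)%N -> (`|z.2| <= l.+1 * r)%N ->
  16%:R^-1 ^+ (k + l) <= plane_hit ((k + l) * n) (fun y => (radius y <= r)%N) z.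
Proof.
move=> hn.
(* If the coordinate is already small enough, the exit is skipped, at the price of a weaker
   bound. *)
have wait j z' : 16%:R^-1 ^+ j <= plane_hit (j * n) (fun y => (radius y <= r)%N) z' ->
    16%:R^-1 ^+ j.+1 <= plane_hit (j.+1 * n) (fun y => (radius y <= r)%N) z'.
  move=> h; apply: le_trans (le_trans h _).
    by rewrite exprS ler_piMl ?exprn_ge0 ?invr_ge0 //; lra.
  by apply: hit_mono; [exact: St_gt0|rewrite mulSn leq_addl].
have p0 j : 0 <= (16%:R^-1 : R) ^+ j by rewrite exprn_ge0 ?invr_ge0.
elim: k z => [|k IHk] z.
  elim: l z => [|l IHl] z h1 h2.
    rewrite hit_now; first by rewrite expr0.
      exact: St_gt0.
    by rewrite /radius geq_max; rewrite !mul1n in h1 h2; rewrite h1 h2.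
  rewrite add0n in IHl *.
  have [h|h] := leqP `|z.2|%N (l.+1 * r)%N; first exact/wait/IHl.
  rewrite exprSr mulSn; apply: (steer_snd hn) => //; first by lia.
  move=> y e1 e2; apply: IHl; last by lia.
  by apply: leq_trans e2 _; rewrite geq_max h1 mul1n leqnn.
move=> h1 h2; rewrite addSn.
have [h|h] := leqP `|z.1|%N (k.+1 * r)%N; first exact/wait/IHk.
rewrite exprSr mulSn; apply: (steer_fst hn) => //; first by lia.
move=> y e1 e2; apply: IHk; first by lia.
by apply: leq_trans e2 _; rewrite geq_max h2 mulSn leq_addr.
Qed.

(** * The lattice walk seen through its projection *)

Definition unit_step (s : St) : 'rV[int]_d := (-1) ^+ s.2 *: delta_mx 0 s.1.

Definition step (x : 'rV[int]_d) s := x + unit_step s.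

Definition plane_proj (x : 'rV[int]_d) : plane := (x 0 i0, x 0 i1).

Lemma plane_proj_step x s : plane_proj (step x s) = plane_move (plane_proj x) s.
Proof.
case: s => i b; rewrite /plane_proj /plane_move /step /unit_step !mxE /= ![_ == i]eq_sym.
have [->|_] := eqVneq i i0; first by rewrite (negPf i01) mulr1 mulr0 addr0.
by case: eqP => _; rewrite ?mulr1 ?mulr0 ?addr0.
Qed.

Definition spreads r (c : plane) (x : 'rV[int]_d) (t : seq St) :=
  (r <= size (undup [seq y <- trajectory step x t |
                       (radius (plane_proj y - c)%R <= 2 * r)%N]))%N.

Lemma spreads_rcons r c x t s : spreads r c x t -> spreads r c x (rcons t s).
Proof.
rewrite /spreads trajectory_rcons => h; apply: leq_trans h _.
apply: uniq_leq_size => [|y]; first exact: undup_uniq.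
by rewrite !mem_undup !mem_filter mem_rcons inE => /andP[-> ->]; rewrite orbT.
Qed.

Lemma spreads_cons r c x t s : spreads r c (step x s) t -> spreads r c x (s :: t).
Proof.
rewrite /spreads trajectory_cons => h; apply: leq_trans h _.
apply: uniq_leq_size => [|y]; first exact: undup_uniq.
by rewrite !mem_undup !mem_filter inE => /andP[-> ->]; rewrite orbT.
Qed.

(* A path from [x] to distance [r] meets every smaller distance. *)
Lemma spreads_exit r c x t : (radius (plane_proj x - c)%R <= r)%N ->
  hits step (fun y => r <= radius (plane_proj y - plane_proj x)%R)%N x t ->
  spreads r c x t.
Proof.
move=> rx h; pose f (y : 'rV[int]_d) := radius (plane_proj y - plane_proj x)%R.
rewrite /spreads; set l := undup _.
apply: (@leq_trans (size (map f l))); last by rewrite size_map.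
rewrite -[X in (X <= _)%N](size_iota 0); apply: uniq_leq_size; first exact: iota_uniq.
move=> j; rewrite mem_iota add0n => /andP[_ jr].
have : hits step (fun y => f y == j) x t.
  apply: hits_level h => [y s||y hy].
  - by rewrite /f plane_proj_step radius_move.
  - by rewrite /f subrr /radius.
  - exact: leq_trans (ltnW jr) hy.
case/hasP => y yt /eqP fy; apply/mapP; exists y => //.
(* A site within [r] of [x], itself within [r] of [c], is within [2 r] of [c]. *)
rewrite mem_undup mem_filter yt andbT.
move: rx fy; rewrite /f /radius /=; lia.
Qed.

(** Distance at most [7 r] requires 6 exits per coordinate, each of probability at least 1/16, to
    come within [r] of [c]; going then to distance [r] from the entrance point has probability at
    least 1/2. Only [n] depends on [r]. *)
Lemma spreads_often r : exists n, forall c x,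
  (radius (plane_proj x - c)%R <= 7 * r)%N ->
  16%:R^-1 ^+ 13 <= average R n (spreads r c x).
Proof.
have [n hn] := exit_half_side r; have [n' hn'] := exit_half r.
exists (12 * n + n')%N => c x hx.
have h1 : 16%:R^-1 ^+ 12 <= hit R step (12 * n)
    (fun y => radius (plane_proj y - c)%R <= r)%N x.
  apply: le_trans (steer (k := 6) (l := 6) (z := plane_proj x - c) hn _ _) _.
  - by move: hx; rewrite /radius geq_max => /andP[].
  - by move: hx; rewrite /radius geq_max => /andP[].
  pose T (y : plane) := (radius (y - c)%R <= r)%N.
  rewrite -(@hit_morph R St _ _ step plane_move (12 * n) T plane_proj id) //.
  - rewrite -[plane_proj x in leRHS](subrK c) [leRHS]hit_translate.
    by apply: hit_sub => y; rewrite /T addrK.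
  - exact: St_gt0.
  - exact: plane_proj_step.
have h2 (y : 'rV[int]_d) : (radius (plane_proj y - c)%R <= r)%N ->
    2%:R^-1 <= average R n' (spreads r c y).
  move=> hy; apply: le_trans hn' _.
  pose T (z : plane) := (r <= radius (z - plane_proj y)%R)%N.
  apply: (@le_trans _ _ (hit R step n' (T \o plane_proj) y)).
    rewrite -(@hit_morph R St _ _ step plane_move n' T plane_proj id) //.
    - rewrite -[plane_proj y in leRHS]add0r [leRHS]hit_translate.
      by apply: hit_sub => z; rewrite /T addrK.
    - exact: St_gt0.
    - exact: plane_proj_step.
  by apply: average_le => t; exact: spreads_exit.
apply: (@le_trans _ _ (2%:R^-1 * 16%:R^-1 ^+ 12)).
  rewrite [leLHS]exprS ler_wpM2r ?exprn_ge0 ?invr_ge0 //; lra.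
apply: le_trans (ler_wpM2l _ h1) _; first by rewrite invr_ge0.
apply: average_after_hit h2; first exact: St_gt0.
- by move=> *; exact: spreads_rcons.
- by move=> *; exact: spreads_cons.
- by rewrite invr_ge0.
Qed.

End PlaneWalk.

Local Open Scope classical_set_scope.

(** * Activation times *)

Section NatTimes.
Context {R : realType}.
Implicit Types (x y : \bar R) (A : set (\bar R)).

(** All passage times have this form, so the infima that define them are attained when finite. *)
Definition nat_time x := x = +oo%E \/ exists n : nat, x = n%:R%:E.

Lemma nat_time_ge0 x : nat_time x -> (0 <= x)%E.
Proof. by case=> [->|[n ->]]; rewrite ?leey // lee_fin. Qed.

Lemma nat_timeD x y : nat_time x -> nat_time y -> nat_time (x + y)%E.
Proof.
case=> [->|[n ->]]; first by move/nat_time_ge0 => h; left; rewrite addye // -ltNye (lt_le_trans _ h).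
case=> [->|[n' ->]]; first by left.
by right; exists (n + n')%N; rewrite natrD.
Qed.

Lemma nat_timeD_fin x y (n : nat) : nat_time x -> nat_time y ->
  (x + y)%E = n%:R%:E -> exists2 a : nat, x = a%:R%:E &
  (a <= n)%N /\ y = (n - a)%:R%:E.
Proof.
case=> [->|[a ->]]; first by move/nat_time_ge0 => h; rewrite addye // -ltNye (lt_le_trans _ h).
case=> [->|[b ->]] //; rewrite -EFinD -natrD => -[] /eqP; rewrite eqr_nat => /eqP <-.
by exists a => //; rewrite leq_addr addKn.
Qed.

Lemma ereal_inf_nat_time A (n : nat) : (forall x, A x -> nat_time x) ->
  ereal_inf A = n%:R%:E <->
  A n%:R%:E /\ forall k : nat, (k < n)%N -> ~ A k%:R%:E.
Proof.
move=> hA; split=> [e|[An hn]]; last first.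
  apply/le_anti; rewrite ereal_inf_lbound //=.
  apply: le_ereal_inf_tmp => x Ax; case: (hA x Ax) => [->|[k xk]]; first exact: leey.
  rewrite xk lee_fin ler_nat leqNgt; apply/negP => /hn; apply; by rewrite -xk.
have small k : (k < n)%N -> ~ A k%:R%:E.
  move=> kn Ak; have := ereal_inf_lbound Ak.
  by rewrite e lee_fin ler_nat leqNgt kn.
split=> //; apply: contrapT => nA.
(* If [n] is not a member, every element is at least [n + 1], and so is the infimum. *)
suff : ((n%:R + 1)%:E <= ereal_inf A)%E by rewrite e lee_fin gerDl ler10.
apply: le_ereal_inf_tmp => x Ax; case: (hA x Ax) => [->|[k xk]]; first exact: leey.
rewrite xk lee_fin natr1 ler_nat ltn_neqAle; apply/andP; split.
  by apply/eqP => nk; apply: nA; rewrite nk -xk.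
by rewrite leqNgt; apply/negP => /small; apply; rewrite -xk.
Qed.

Lemma nat_time_ereal_inf A : (forall x, A x -> nat_time x) -> nat_time (ereal_inf A).
Proof.
move=> hA; have [[n An]|no] := pselect (exists n : nat, A n%:R%:E).
  have [k /asboolP Ak kmin] := ex_minnP (ex_intro (fun k : nat => `[< A k%:R%:E >]) n (asboolT An)).
  right; exists k; apply/ereal_inf_nat_time => //; split=> // j jk Aj.
  by have := kmin j (asboolT Aj); rewrite leqNgt jk.
left; apply/ereal_inf_pinfty => x Ax; case: (hA x Ax) => [->//|[k xk]].
by case: no; exists k; rewrite -xk.
Qed.

End NatTimes.

Section Activation.
Context {R : realType} {V : countType} (root : V).
Context {d : measure_display} {Omega : measurableType d}.
Variable P : probability Omega R.
Variables (eta : V -> {RV P >-> nat}) (S : V -> nat -> nat -> Omega -> V)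
          (Xi : V -> nat -> {RV P >-> \bar R}).

Local Notation hit := (hitting_time eta S Xi).
Local Notation T := (activation_time root eta S Xi).

Definition walks_to w x i n y :=
  [/\ (i < eta x w)%N, (n%:R%:E < Xi x i w)%E & S x i n w = y].

Lemma hitting_set_nat w x y (t : \bar R) :
  [set n%:R%:E | n in [set n : nat | exists i : nat, walks_to w x i n y]] t -> nat_time t.
Proof. by case=> n _ <-; right; exists n. Qed.

Lemma nat_time_hitting w x y : nat_time (hit w x y).
Proof. exact/nat_time_ereal_inf/hitting_set_nat. Qed.

Lemma hitting_time_le w x y i n : walks_to w x i n y -> (hit w x y <= n%:R%:E)%E.
Proof. by move=> h; apply: ereal_inf_lbound; exists n => //; exists i. Qed.

Lemma hitting_timeP w x y (n : nat) : hit w x y = n%:R%:E <->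
  (exists i, walks_to w x i n y) /\
  forall k, (k < n)%N -> ~ exists i, walks_to w x i k y.
Proof.
have mem (k : nat) : [set n%:R%:E | n in [set n : nat | exists i : nat, walks_to w x i n y]]
    (k%:R%:E : \bar R) <-> exists i, walks_to w x i k y.
  split=> [[j hj [/eqP]]|h]; last by exists k.
  by rewrite eqr_nat => /eqP <-.
apply: iff_trans (ereal_inf_nat_time n (@hitting_set_nat w x y)) _.
split=> -[/mem h1 h2]; split=> // k /h2; first by move=> h /mem.
by move=> h /mem.
Qed.

Definition path_time w x (s : seq V) : \bar R :=
  (\sum_(e <- zip (x :: s) s) hit w e.1 e.2)%E.

Lemma path_time_nil w x : path_time w x [::] = 0%E.
Proof. by rewrite /path_time /= big_nil. Qed.

Lemma path_time_cons w x y s :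
  path_time w x (y :: s) = (hit w x y + path_time w y s)%E.
Proof. by rewrite /path_time /= big_cons. Qed.

Lemma path_time_rcons w x s y :
  path_time w x (rcons s y) = (path_time w x s + hit w (last x s) y)%E.
Proof.
elim: s x => [|z s IH] x /=; first by rewrite path_time_cons !path_time_nil add0e adde0.
by rewrite !path_time_cons IH addeA.
Qed.

Lemma nat_time_path w x s : nat_time (path_time w x s).
Proof.
elim: s x => [|y s IH] x; first by rewrite path_time_nil; right; exists 0%N.
by rewrite path_time_cons; apply: nat_timeD => //; exact: nat_time_hitting.
Qed.

Lemma activation_set_nat w x (t : \bar R) :
  [set path_time w root s | s in [set s | last root s = x]] t -> nat_time t.
Proof. by case=> s _ <-; exact: nat_time_path. Qed.

Lemma nat_time_activation w x : nat_time (T w x).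
Proof. exact/nat_time_ereal_inf/activation_set_nat. Qed.

Lemma activation_timeP w x (n : nat) : T w x = n%:R%:E <->
  (exists2 s, last root s = x & path_time w root s = n%:R%:E) /\
  forall k : nat, (k < n)%N -> ~ exists2 s, last root s = x & path_time w root s = k%:R%:E.
Proof. exact: (ereal_inf_nat_time n (@activation_set_nat w x)). Qed.

Lemma activation_time_le w s : (T w (last root s) <= path_time w root s)%E.
Proof. by apply: ereal_inf_lbound; exists s. Qed.

Lemma activation_time_root w : T w root = 0%E.
Proof.
apply/le_anti; rewrite nat_time_ge0 ?andbT; last exact: nat_time_activation.
by rewrite -(path_time_nil w root); exact: (activation_time_le w [::]).
Qed.

Lemma activation_time_step w x y (m k : nat) : T w x = m%:R%:E ->
  (hit w x y <= k%:R%:E)%E -> (T w y <= (m + k)%:R%:E)%E.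
Proof.
move=> /activation_timeP[[s sx es] _] h.
have := activation_time_le w (rcons s y); rewrite last_rcons path_time_rcons sx es.
by move=> h'; apply: le_trans h' _; rewrite natrD EFinD leeD2l.
Qed.

Definition activated w x := exists m : nat, T w x = m%:R%:E.

Lemma activated_root w : activated w root.
Proof. by exists 0%N; rewrite activation_time_root. Qed.

Lemma activated_step w x i n y : activated w x -> walks_to w x i n y ->
  activated w y.
Proof.
case=> m Tx /hitting_time_le h; have := activation_time_step Tx h.
by case: (nat_time_activation w y) => [->|//]; rewrite leye_eq.
Qed.

(* Along a path of finite passage time to [x], some particle activated before
   time [n] has to reach a site activated after time [n]. *)
Lemma active_of_late_activation w x (m n : nat) : T w x = m%:R%:E -> (n < m)%N ->
  exists y i, active_particle root eta S Xi w n y i.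
Proof.
move=> Tx nm; have /activation_timeP[[s sx es] _] := Tx.
suff H s' u (a b : nat) : T w u = a%:R%:E -> (a <= n)%N -> last u s' = x ->
    path_time w u s' = b%:R%:E -> exists y i, active_particle root eta S Xi w n y i.
  apply: (H s root 0%N m) => //; exact: activation_time_root.
elim: s' u a b => [|v s' IH] u a b Tu an /=.
  by move=> ux; move: Tx; rewrite -ux Tu => -[] /eqP; rewrite eqr_nat => /eqP; lia.
move=> lx; rewrite path_time_cons => /nat_timeD_fin[||k hk [_ hb]].
- exact: nat_time_hitting.
- exact: nat_time_path.
have := @activation_time_step w u v a k Tu; rewrite hk lexx => /(_ isT).
case: (nat_time_activation w v) => [->|[a' Tv]]; first by rewrite leye_eq.
rewrite Tv lee_fin ler_nat => a'le.
have [a'n|na'] := leqP a' n; first exact: (IH v a' _ Tv a'n lx hb).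
have /hitting_timeP[[i [h1 h2 _]] _] := hk.
exists u, i; split=> //; exists a => //; split=> //.
by apply: le_lt_trans h2; rewrite lee_fin ler_nat; lia.
Qed.

(** These events decrease in [n], and on their intersection activations occur arbitrarily late,
    which forces survival. *)
Definition late (n : nat) : set Omega :=
  [set w | exists x (m : nat), T w x = m%:R%:E /\ (n < m)%N].

Lemma bigcap_late_survival : \bigcap_n late n `<=` survival root eta S Xi.
Proof.
move=> w hw n; have [x [m [Tx nm]]] := hw n I.
exact: active_of_late_activation Tx nm.
Qed.

(** A function gaining at most one per step of any walk gains at most the passage time along any
    path. It is used for a coordinate of the lattice. *)
Lemma activation_time_ge (g : V -> int) w : g root = 0 ->
  (forall x i, S x i 0%N w = x) ->
  (forall x i n, g (S x i n.+1 w) <= g (S x i n w) + 1) ->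
  forall x (m : nat), T w x = m%:R%:E -> g x <= m%:Z.
Proof.
move=> g0 S0 Sg.
have gS x i n : g (S x i n w) <= g x + n%:Z.
  elim: n => [|n IH]; first by rewrite S0 addr0.
  by have := Sg x i n; lia.
have gp s : forall u (b : nat), path_time w u s = b%:R%:E -> g (last u s) <= g u + b%:Z.
  elim: s => [|v s IH] u b /=; first by lia.
  rewrite path_time_cons => /nat_timeD_fin[||k hk [kb /IH h]].
  - exact: nat_time_hitting.
  - exact: nat_time_path.
  have /hitting_timeP[[i [_ _ e]] _] := hk.
  by have := gS u i k; rewrite e; lia.
move=> x m /activation_timeP[[s <- /gp]]; rewrite g0 add0r; by [].
Qed.

End Activation.

(** * Measurability *)

Lemma measurable_exists d (Omega : measurableType d) (I : countType)
    (Q : I -> Omega -> Prop) :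
  (forall i, measurable [set w | Q i w]) -> measurable [set w | exists i, Q i w].
Proof.
move=> mQ; rewrite (_ : [set w | _] = \bigcup_i [set w | Q i w]).
  by apply: countable_bigcupT_measurable.
by apply/seteqP; split=> w [i]; [exists i|move=> _; exists i].
Qed.

Lemma measurable_and d (Omega : measurableType d) (A B : Omega -> Prop) :
  measurable [set w | A w] -> measurable [set w | B w] ->
  measurable [set w | A w /\ B w].
Proof. exact: measurableI. Qed.

Lemma measurable_cond d (Omega : measurableType d) (C : Prop) (A : Omega -> Prop) :
  (C -> measurable [set w | A w]) -> measurable [set w | C /\ A w].
Proof.
move=> mA; have [c|nc] := pselect C; last first.
  by rewrite (_ : [set w | _] = set0) //; apply/seteqP; split=> w // [].
rewrite (_ : [set w | _] = [set w | A w]); first exact: mA.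
by apply/seteqP; split=> w // [].
Qed.

Lemma measurable_not d (Omega : measurableType d) (A : Omega -> Prop) :
  measurable [set w | A w] -> measurable [set w | ~ A w].
Proof. exact: measurableC. Qed.

Lemma measurable_forall d (Omega : measurableType d) (I : countType)
    (Q : I -> Omega -> Prop) :
  (forall i, measurable [set w | Q i w]) -> measurable [set w | forall i, Q i w].
Proof.
move=> mQ; rewrite (_ : [set w | _] = [set w | ~ exists i, ~ Q i w]).
  by apply/measurable_not/measurable_exists => i; exact: measurable_not.
apply/seteqP; split=> w /= h; first by case=> i; apply.
by move=> i; apply: contrapT => ni; apply: h; exists i.
Qed.

Lemma measurable_before d (Omega : measurableType d) (n : nat)
    (Q : nat -> Omega -> Prop) :
  (forall i, measurable [set w | Q i w]) ->
  measurable [set w | forall i, (i < n)%N -> Q i w].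
Proof.
move=> mQ; apply: measurable_forall => i.
have [lt|ge] := boolP (i < n)%N.
  rewrite (_ : [set w | _] = [set w | Q i w]); first exact: mQ.
  by apply/seteqP; split=> w /=; [apply|].
by rewrite (_ : [set w | _] = setT) //; apply/seteqP; split.
Qed.

Section Measurability.
Context {R : realType} {V : countType} (root : V).
Context {d : measure_display} {Omega : measurableType d}.
Variable P : probability Omega R.
Variables (eta : V -> {RV P >-> nat}) (S : V -> nat -> nat -> Omega -> V)
          (Xi : V -> nat -> {RV P >-> \bar R}).
Hypothesis mS : forall x i n y, measurable (S x i n @^-1` [set y]).

Lemma measurable_eta x (i : nat) : measurable [set w | (i < eta x w)%N].
Proof.
rewrite -[X in measurable X]setTI.
exact: (measurable_funPT (eta x) measurableT [set k | (i < k)%N]).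
Qed.

Lemma measurable_Xi x i (n : nat) : measurable [set w | (n%:R%:E < Xi x i w)%E].
Proof.
rewrite -[X in measurable X]setTI.
have -> : [set w | (n%:R%:E < Xi x i w)%E] = Xi x i @^-1` `]n%:R%:E, +oo[.
  by apply/seteqP; split=> w /=; rewrite in_itv /= andbT.
by apply: (measurable_funPT (Xi x i) measurableT); exact: emeasurable_itv.
Qed.

Lemma measurable_walks_to x i n y :
  measurable [set w | walks_to eta S Xi w x i n y].
Proof.
rewrite (_ : [set w | _] = [set w | (i < eta x w)%N /\
    ((n%:R%:E < Xi x i w)%E /\ S x i n w = y)]); last first.
  by apply/seteqP; split=> w /= [] // ? [].
apply: measurable_and; first exact: measurable_eta.
apply: measurable_and; [exact: measurable_Xi|exact: mS].
Qed.

Lemma measurable_hitting_time x y (n : nat) :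
  measurable [set w | hitting_time eta S Xi w x y = n%:R%:E].
Proof.
rewrite (_ : [set w | _] = [set w | (exists i, walks_to eta S Xi w x i n y) /\
    forall k, (k < n)%N -> ~ exists i, walks_to eta S Xi w x i k y]); last first.
  by apply/seteqP; split=> w /=; rewrite hitting_timeP.
have mw k : measurable [set w | exists i, walks_to eta S Xi w x i k y].
  by apply: measurable_exists => i; exact: measurable_walks_to.
apply: measurable_and; first exact: mw.
by apply: measurable_before => k; apply: measurable_not; exact: mw.
Qed.

Lemma measurable_path_time x s (n : nat) :
  measurable [set w | path_time eta S Xi w x s = n%:R%:E].
Proof.
elim: s x n => [|y s IH] x n.
  under eq_set do rewrite path_time_nil.
  have [e|ne] := pselect (0%E = n%:R%:E :> \bar R).
    by rewrite (_ : [set w | _] = setT) //; apply/seteqP; split.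
  by rewrite (_ : [set w | _] = set0) //; apply/seteqP; split.
(* The total time [n] is split into the time [a] of the first hop and the rest. *)
rewrite (_ : [set w | _] = [set w | exists a : nat, (a <= n)%N /\
   (hitting_time eta S Xi w x y = a%:R%:E /\
    path_time eta S Xi w y s = (n - a)%:R%:E)]).
  apply: measurable_exists => a; apply: measurable_cond => _.
  by apply: measurable_and; [exact: measurable_hitting_time|exact: IH].
apply/seteqP; split=> w /=; rewrite path_time_cons.
  case/nat_timeD_fin=> [||a ha [an hs]]; last by exists a.
    exact: nat_time_hitting.
  exact: nat_time_path.
by case=> a [an [-> ->]]; rewrite -EFinD -natrD subnKC.
Qed.

Lemma measurable_activation_time x (n : nat) :
  measurable [set w | activation_time root eta S Xi w x = n%:R%:E].
Proof.
pose Q (k : nat) w := exists s, last root s = x /\ path_time eta S Xi w root s = k%:R%:E.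
rewrite (_ : [set w | _] = [set w | Q n w /\ forall k, (k < n)%N -> ~ Q k w]).
  have mQ k : measurable [set w | Q k w].
    apply: measurable_exists => s; apply: measurable_cond => _.
    exact: measurable_path_time.
  by apply: measurable_and => //; apply: measurable_before => k; exact: measurable_not.
have QE k w : Q k w <-> exists2 s, last root s = x & path_time eta S Xi w root s = k%:R%:E.
  by split=> [[s []]|[s]]; exists s.
apply/seteqP; split=> w /=; rewrite activation_timeP.
  by case=> h1 h2; split=> [|k /h2 h]; rewrite QE.
by rewrite -QE => -[h1 h2]; split=> // k /h2; rewrite QE.
Qed.

Lemma measurable_survival : measurable (survival root eta S Xi).
Proof.
apply: measurable_forall => n; apply: measurable_exists => x.
apply: measurable_exists => i; apply: measurable_and; first exact: measurable_eta.
rewrite (_ : [set w | _] = [set w | exists m : nat, (m <= n)%N /\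
   (activation_time root eta S Xi w x = m%:R%:E /\ ((n - m)%:R%:E < Xi x i w)%E)]).
  apply: measurable_exists => m; apply: measurable_cond => _.
  by apply: measurable_and; [exact: measurable_activation_time|exact: measurable_Xi].
by apply/seteqP; split=> w /= [m]; [move=> h1 [h2 h3]|case=> h1 [h2 h3]]; exists m.
Qed.

Lemma measurable_late n : measurable (late root eta S Xi n).
Proof.
apply: measurable_exists => x; apply: measurable_exists => m.
rewrite (_ : [set w | _] = [set w | (n < m)%N /\
   activation_time root eta S Xi w x = m%:R%:E]).
  by apply: measurable_cond => _; exact: measurable_activation_time.
by apply/seteqP; split=> w /= [].
Qed.

(** Continuity from above along the decreasing events [late n]. *)
Lemma survival_ge (c : R) :
  (forall n, (c%:E <= P (late root eta S Xi n))%E) ->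
  (c%:E <= P (survival root eta S Xi))%E.
Proof.
move=> hc; pose F := late root eta S Xi.
have mF : measurable (\bigcap_n F n).
  by apply: bigcapT_measurable => n; exact: measurable_late.
apply: (@le_trans _ _ (P (\bigcap_n F n))); last first.
  apply: le_measure; rewrite ?inE //; first exact: measurable_survival.
  exact: bigcap_late_survival.
have cv : (P \o F) n @[n --> \oo] --> P (\bigcap_n F n).
  apply: nonincreasing_cvg_mu => //.
  - by rewrite (le_lt_trans (probability_le1 P (measurable_late 0))) ?ltry.
  - exact: measurable_late.
  - move=> n n' nn'; apply/subsetPset => w [x [m [Tx mn]]].
    by exists x, m; split=> //; apply: leq_ltn_trans mn.
rewrite -(cvg_lim _ cv) //; apply: lime_ge; first by apply/cvg_ex; exists (P (\bigcap_n F n)).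
by apply: nearW => n; exact: hc.
Qed.

End Measurability.

(** * Law of the outcomes *)

Section RealProbability.
Context {R : realType} {d : measure_display} {Omega : measurableType d}.
Variable P : probability Omega R.

Definition pr (A : set Omega) : R := fine (P A).

Lemma prE A : measurable A -> P A = (pr A)%:E.
Proof. by move=> mA; rewrite fineK // fin_num_measure. Qed.

Lemma pr_ge0 A : 0 <= pr A. Proof. exact: fine_ge0. Qed.

Lemma pr_le A B : measurable A -> measurable B -> A `<=` B -> pr A <= pr B.
Proof.
move=> mA mB AB; rewrite -lee_fin -!prE //.
by apply: le_measure; rewrite ?inE.
Qed.

Lemma pr_setT : pr setT = 1.
Proof. by rewrite /pr probability_setT. Qed.

Lemma prU A B : measurable A -> measurable B -> A `&` B = set0 ->
  pr (A `|` B) = pr A + pr B.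
Proof.
move=> mA mB AB; apply: EFin_inj; rewrite EFinD -!prE //; last exact: measurableU.
by rewrite measureU.
Qed.

Lemma pr_le1 A : measurable A -> pr A <= 1.
Proof. by move=> mA; rewrite -pr_setT; exact: pr_le. Qed.

Lemma pr_sum (I : finType) (A : set Omega) (E : I -> set Omega) :
  measurable A -> (forall i, measurable (E i)) ->
  (forall i j w, E i w -> E j w -> i = j) ->
  \sum_i pr (A `&` E i) = pr (A `&` [set w | exists i, E i w]).
Proof.
move=> mA mE dE; rewrite -big_enum /=.
have : uniq (enum I) by exact: enum_uniq.
have -> : [set w | exists i, E i w] = [set w | (exists2 i, i \in enum I & E i w)].
  apply/seteqP; split=> w /= [i]; last by exists i.
  by move=> h; exists i; rewrite ?mem_enum.
elim: (enum I) => [_|i r IH /= /andP[ir ur]].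
  rewrite big_nil (_ : _ `&` _ = set0); first by rewrite /pr measure0.
  by apply/seteqP; split=> w // [_ []].
have mr : measurable [set w | (exists2 j, j \in r & E j w)].
  rewrite (_ : [set w | _] = [set w | exists j, j \in r /\ E j w]).
    by apply: measurable_exists => j; apply: measurable_cond => _; exact: mE.
  by apply/seteqP; split=> w /= [j]; [move=> *; exists j|case=> *; exists j].
rewrite big_cons IH // -prU; [|exact: measurableI|exact: measurableI|].
  rewrite -setIUr; congr (pr (A `&` _)); apply/seteqP; split=> w /=.
    by case=> [h|[j jr h]]; [exists i|exists j]; rewrite ?mem_head // inE jr orbT.
  by case=> j; rewrite inE => /orP[/eqP->|jr] h; [left|right; exists j].
apply/seteqP; split=> w // [[_ h1] [_ [j jr h2]]].
by move: ir; rewrite (dE _ _ _ h1 h2) jr.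
Qed.

Lemma null_exists (I : countType) (Q : I -> Omega -> Prop) :
  (forall i, measurable [set w | Q i w]) -> (forall i, P [set w | Q i w] = 0%E) ->
  P [set w | exists i, Q i w] = 0%E.
Proof.
move=> mQ Q0; apply/negligibleP; first exact: measurable_exists.
(* The union is indexed by codes; a number that codes no element contributes the empty set. *)
rewrite (_ : [set w | _] =
    \bigcup_(n in [set: nat]) [set w | (exists2 i : I, @choice.unpickle I n = Some i & Q i w)]).
  apply: negligible_bigcup => n; case en: (@choice.unpickle I n) => [i|].
    rewrite (_ : [set w | _] = [set w | Q i w]).
      by apply/negligibleP; [exact: mQ|exact: Q0].
    by apply/seteqP; split=> w /= => [[j [<-]]|h] //; exists i.
  rewrite (_ : [set w | _] = set0); first exact: negligible_set0.
  by apply/seteqP; split=> w // [].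
apply/seteqP; split=> w /= [i]; first by exists (choice.pickle i) => //; exists i; rewrite ?choice.pickleK.
by move=> _ [j _ h]; exists j.
Qed.

End RealProbability.

(** * Joint law of the first particles of distinct sites *)

Section Outcomes.
Context {R : realType} {V : countType}.
Context {d : measure_display} {Omega : measurableType d}.
Variable P : probability Omega R.
Variables (eta : V -> {RV P >-> nat}) (S : V -> nat -> nat -> Omega -> V)
          (Xi : V -> nat -> {RV P >-> \bar R}).
Variables (St : finType) (move : V -> St -> V) (L : nat).
Hypothesis St_gt0 : (0 < #|St|)%N.
Hypothesis move_inj : forall x, injective (move x).
Hypothesis mS : forall x i n y, measurable (S x i n @^-1` [set y]).
Hypothesis indep : independent_systems P (frog_sigma eta S Xi).

Local Notation N := (#|St|%:R : R).
Local Notation path := (L.-tuple St).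

Definition position x (t : seq St) k := foldl move x (take k t).

Definition follows x (t : seq St) : set Omega :=
  [set w | forall k, (k < L.+1)%N -> S x 0%N k w = position x t k].

Definition populated x : set Omega := [set w | (0 < eta x w)%N].

Definition long_lived x : set Omega := [set w | (L%:R%:E < Xi x 0%N w)%E].

Definition frog_path x (t : path) : set Omega :=
  populated x `&` (follows x t `&` long_lived x).

(* [None] means that the first particle of [x] is missing, dies too early, or
   makes an impossible step. *)
Definition outcome_event x (o : option path) : set Omega :=
  if o is Some t then frog_path x t else [set w | ~ exists t, frog_path x t w].

Hypothesis pr_follows : forall x (t : path), pr P (follows x t) = N^-1 ^+ L.

Definition frog_prob x : R := pr P (populated x) * pr P (long_lived x).

Definition outcome_prob x (o : option path) : R :=
  if o is Some _ then frog_prob x * N^-1 ^+ L else 1 - frog_prob x.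

Lemma measurable_follows x t : measurable (follows x t).
Proof. by apply: measurable_before => k; exact: mS. Qed.

Lemma measurable_populated x : measurable (populated x).
Proof. exact: measurable_eta. Qed.

Lemma measurable_long_lived x : measurable (long_lived x).
Proof. exact: measurable_Xi. Qed.

Lemma measurable_frog_path x t : measurable (frog_path x t).
Proof.
apply: measurableI; first exact: measurable_populated.
by apply: measurableI; [exact: measurable_follows|exact: measurable_long_lived].
Qed.

Lemma measurable_outcome x o : measurable (outcome_event x o).
Proof.
case: o => [t|] /=; first exact: measurable_frog_path.
by apply/measurable_not/measurable_exists => t; exact: measurable_frog_path.
Qed.

Lemma positionS x (t : path) k (hk : (k < L)%N) :
  position x t k.+1 = move (position x t k) (tnth t (Ordinal hk)).
Proof.
rewrite /position (take_nth (tnth t (Ordinal hk))) ?size_tuple //.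
by rewrite foldl_rcons; congr (move _ _); exact/esym/tnth_nth.
Qed.

(** Moves from a given point are injective, so the successive positions determine the steps. *)
Lemma frog_path_inj x t t' w : frog_path x t w -> frog_path x t' w -> t = t'.
Proof.
move=> [_ [h _]] [_ [h' _]]; apply: eq_from_tnth => -[k hk].
have e j : (j <= L)%N -> position x t j = position x t' j.
  by move=> jL; rewrite -h ?ltnS // h'.
have := e k.+1 hk; rewrite !positionS e; last exact: ltnW.
exact: move_inj.
Qed.

Lemma outcome_inj x o o' w : outcome_event x o w -> outcome_event x o' w -> o = o'.
Proof.
case: o o' => [t|] [t'|] //= h h'; first by rewrite (frog_path_inj h h').
  by case: h'; exists t.
by case: h; exists t'.
Qed.

Lemma frog_prob_ge0 x : 0 <= frog_prob x.
Proof. by rewrite mulr_ge0 ?pr_ge0. Qed.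

Lemma frog_prob_le1 x : frog_prob x <= 1.
Proof.
rewrite mulr_ile1 ?pr_ge0 ?pr_le1 //; first exact: measurable_populated.
exact: measurable_long_lived.
Qed.

Lemma outcome_prob_ge0 x o : 0 <= outcome_prob x o.
Proof.
case: o => [t|] /=; last by rewrite subr_ge0 frog_prob_le1.
by rewrite mulr_ge0 ?frog_prob_ge0 // exprn_ge0 // invr_ge0.
Qed.

Lemma sum_paths (c : R) : \sum_(t : path) c * N^-1 ^+ L = c.
Proof.
rewrite sumr_const card_tuple -mulrnAr -mulr_natl natrX -exprMn divff ?expr1n ?mulr1 //.
by rewrite pnatr_eq0 -lt0n.
Qed.

Lemma sum_option (I : finType) (f : option I -> R) :
  \sum_o f o = f None + \sum_i f (Some i).
Proof.
rewrite (bigD1 None) //=; congr (_ + _).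
rewrite (reindex_omap Some id) /=; last by case.
by apply: eq_bigl => j; rewrite eqxx.
Qed.

Lemma outcome_prob_sum1 x : \sum_o outcome_prob x o = 1.
Proof. by rewrite sum_option /= sum_paths subrK. Qed.

(** Independence is applied to three events per site: presence, walk and lifetime of its particle
    number 0. *)
Lemma pr_frog_paths (xs : seq V) (t : V -> path) : uniq xs ->
  pr P [set w | forall x, x \in xs -> frog_path x (t x) w] =
  \prod_(x <- xs) outcome_prob x (Some (t x)).
Proof.
move=> uxs.
pose A (j : V + (V * nat) + (V * nat)) : set Omega := match j with
  | inl (inl x) => populated x
  | inl (inr (x, _)) => follows x (t x)
  | inr (x, _) => long_lived x end.
pose l := [seq inl (inl x) | x <- xs] ++
  ([seq inl (inr (x, 0%N)) | x <- xs] ++ [seq inr (x, 0%N) | x <- xs])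
  : seq (V + (V * nat) + (V * nat)).
have ul : uniq l.
  rewrite /l !cat_uniq !map_inj_uniq ?uxs //=; try by move=> ? ? [].
  rewrite andbT; apply/andP; split; apply/hasPn => j.
    by rewrite mem_cat => /orP[] /mapP[x _ ->]; apply/negP => /mapP[].
  by case/mapP=> x _ ->; apply/negP => /mapP[].
have lE : seq_fset tt l =i l by exact: seq_fsetE.
have hA j : j \in seq_fset tt l -> frog_sigma eta S Xi j (A j).
  rewrite lE /l !mem_cat => /or3P[] /mapP[x _ ->] /=.
  - by exists [set k | (0 < k)%N] => //; rewrite setTI.
  - pose G := [set A0 | exists n y, A0 = S x 0%N n @^-1` [set y]].
    (* Measurability is needed here for the sigma-algebra generated by this walk, not the ambient
       one. *)
    apply: (@measurable_before _ (g_sigma_algebraType G)) => k.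
    by apply: sub_gen_smallest; exists k, (position x (t x) k).
  - exists `]L%:R%:E, +oo[%classic; first exact: emeasurable_itv.
    by rewrite setTI; apply/seteqP; split=> w /=; rewrite in_itv /= andbT.
have := indep hA.
rewrite (_ : \bigcap_(i in _) A i =
   [set w | forall x, x \in xs -> frog_path x (t x) w]); last first.
  apply/seteqP; split=> w /= h.
    move=> x hx; have hl j : j \in l -> A j w by move=> jl; apply: h; rewrite /= lE.
    split; first by apply: (hl (inl (inl x))); rewrite /l !mem_cat map_f.
    split; first by apply: (hl (inl (inr (x, 0%N)))); rewrite /l !mem_cat (map_f (fun x => inl (inr (x, 0%N)))) ?orbT.
    by apply: (hl (inr (x, 0%N))); rewrite /l !mem_cat (map_f (fun x => inr (x, 0%N))) ?orbT.
  by move=> j; rewrite /= lE /l !mem_cat => /or3P[] /mapP[x /h[? []] ? ? ->].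
rewrite (perm_big l) /=; last first.
  by apply: uniq_perm; [exact: sort_keys_uniq|exact: ul|exact: sort_keysE].
rewrite /l !big_cat /= !big_map /= => e.
apply: EFin_inj; rewrite -prE; last first.
  rewrite (_ : [set w | _] = [set w | forall x, ~ x \in xs \/ frog_path x (t x) w]); last first.
    apply/seteqP; split=> w /= h x; last by move=> hx; case: (h x).
    by have [hx|hx] := pselect (x \in xs); [right; exact: h|left].
  apply: measurable_forall => x; have [hx|hx] := boolP (x \in xs).
    rewrite (_ : [set w | _] = frog_path x (t x)); first exact: measurable_frog_path.
    by apply/seteqP; split=> w /=; [case|right].
  by rewrite (_ : [set w | _] = setT) //; apply/seteqP; split=> w //= _; left.
rewrite e -prodEFin -!big_split /=.
apply: eq_bigr => x _.
rewrite (prE P (measurable_populated x)) (prE P (measurable_follows _ _)).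
rewrite (prE P (measurable_long_lived x)) pr_follows -!EFinM; congr (_%:E).
by rewrite /frog_prob -mulrA [_ ^+ L * _]mulrC.
Qed.

Definition history_event (h : seq (V * option path)) : set Omega :=
  [set w | forall x o, (x, o) \in h -> outcome_event x o w].

Lemma measurable_history h : measurable (history_event h).
Proof.
rewrite (_ : history_event h =
  [set w | forall a : V * option path, ~ a \in h \/ outcome_event a.1 a.2 w]).
  apply: measurable_forall => -[x o] /=; have [hx|hx] := boolP ((x, o) \in h).
    rewrite (_ : [set w | _] = outcome_event x o); first exact: measurable_outcome.
    by apply/seteqP; split=> w /=; [case|right].
  by rewrite (_ : [set w | _] = setT) //; apply/seteqP; split=> w //= _; left.
apply/seteqP; split=> w /= h0.
  by case=> x o; have [hx|hx] := pselect ((x, o) \in h); [right; exact: h0|left].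
by move=> x o hx; case: (h0 (x, o)).
Qed.

Lemma history_cat h h' : history_event (h ++ h') = history_event h `&` history_event h'.
Proof.
apply/seteqP; split=> w /=.
  by move=> hw; split=> x o xo; apply: hw; rewrite mem_cat xo ?orbT.
by case=> h1 h2 x o; rewrite mem_cat => /orP[/h1|/h2].
Qed.

Lemma history_cons x o h : history_event ((x, o) :: h) =
  outcome_event x o `&` history_event h.
Proof.
rewrite -cat1s history_cat; congr (_ `&` _); apply/seteqP; split=> w /=.
  by apply; rewrite mem_head.
by move=> hw y o'; rewrite inE => /eqP[-> ->].
Qed.

(** Outcomes [Some t] factor by independence. An outcome [None] is the complement of the paths of
    its site, so its formula follows by subtraction. *)
Lemma pr_history h : uniq (map fst h) ->
  pr P (history_event h) = \prod_(a <- h) outcome_prob a.1 a.2.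
Proof.
(* The induction replaces each [None] of [h] by paths, which are collected in [h']. *)
suff H h' : uniq (map fst (h ++ h')) -> all (fun a : V * option path => a.2 : bool) h' ->
    pr P (history_event (h ++ h')) = \prod_(a <- h ++ h') outcome_prob a.1 a.2.
  by move=> uh; have := H [::]; rewrite cats0; apply.
elim: h h' => [|[x o] h IH] h' /=.
  move=> uh /allP sh; case: h' uh sh => [|a0 h'] uh sh.
    rewrite big_nil (_ : history_event _ = setT) ?pr_setT //.
    by apply/seteqP; split.
  set h0 := a0 :: h' in uh sh *.
  have : isSome a0.2 by apply: sh; rewrite mem_head.
  case: a0 @h0 uh sh => x0 [t0|] //= uh sh _.
  set h0 := (x0, Some t0) :: h' in uh sh *.
  (* The path attached to each site is looked up in the list; [t0] fills in elsewhere. *)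
  pose t x := odflt t0 (nth (x0, Some t0) h0 (index x (map fst h0))).2.
  have ht a : a \in h0 -> a = (a.1, Some (t a.1)).
    move=> ah; have := sh _ ah; rewrite /t.
    have -> : nth (x0, Some t0) h0 (index a.1 (map fst h0)) = a.
      rewrite -[X in index X.1](nth_index (x0, Some t0) ah).
      rewrite -(nth_map _ x0) ?index_mem // index_uniq ?size_map ?index_mem //.
      by rewrite nth_index.
    by case: a {ah} => x [].
  have := @pr_frog_paths (map fst h0) t uh; rewrite big_map => e.
  rewrite (_ : history_event _ =
    [set w | forall x, x \in map fst h0 -> frog_path x (t x) w]).
    rewrite e big_seq [RHS]big_seq; apply: eq_bigr => a /ht ->; by [].
  apply/seteqP; split=> w hw; last first.
    move=> x o ao; have /(congr1 snd) /= -> := ht _ ao.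
    by apply: hw; apply/mapP; exists (x, o).
  move=> x /mapP[a ah ->]; have := hw a.1 a.2; rewrite -surjective_pairing => /(_ ah).
  by rewrite [in a.2](ht _ ah).
move=> uh sh.
have some t : pr P (frog_path x t `&` history_event (h ++ h')) =
    outcome_prob x (Some t) * \prod_(a <- h ++ h') outcome_prob a.1 a.2.
  have p : perm_eq (h ++ (x, Some t) :: h') ((x, Some t) :: h ++ h').
    by rewrite -cat1s perm_catCA.
  have := IH ((x, Some t) :: h').
  rewrite (perm_uniq (perm_map fst p)) (perm_big _ p) big_cons /= => /(_ uh sh) <-.
  congr (pr P _); rewrite -[frog_path x t]/(outcome_event x (Some t)) -history_cons.
  by apply/seteqP; split=> w /= hw y o' yo; apply: hw; rewrite (perm_mem p) in yo *.
rewrite history_cons big_cons /=; case: o uh => [t|] /= uh; first exact: some.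
have mh := measurable_history (h ++ h').
have mE : measurable [set w | exists t, frog_path x t w].
  by apply: measurable_exists => t; exact: measurable_frog_path.
have IHn : pr P (history_event (h ++ h')) = \prod_(a <- h ++ h') outcome_prob a.1 a.2.
  by apply: IH => //; case/andP: uh.
have : pr P (history_event (h ++ h')) =
    pr P (history_event (h ++ h') `&` [set w | exists t, frog_path x t w]) +
    pr P ([set w | ~ exists t, frog_path x t w] `&` history_event (h ++ h')).
  rewrite -prU; [|exact: measurableI|apply: measurableI => //; exact: measurable_not|].
    congr (pr P _); apply/seteqP; split=> w /=; last by case=> -[].
    by move=> hw; have [e|ne] := pselect (exists t, frog_path x t w); [left|right].
  by apply/seteqP; split=> w //= [[_ e] [ne _]].
rewrite -pr_sum //; [|by move=> t; exact: measurable_frog_path|exact: frog_path_inj].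
rewrite (eq_bigr (fun t => outcome_prob x (Some t) * \prod_(a <- h ++ h') outcome_prob a.1 a.2));
  last by move=> t _; rewrite setIC some.
rewrite -mulr_suml /= sum_paths IHn; set q := \prod_(_ <- _) _; lra.
Qed.

End Outcomes.

(** * Simple random walk on the lattice *)

Section WalkLaw.
Context {R : realType} {V : countType} (adj : rel V).
Context {d : measure_display} {Omega : measurableType d}.
Variable P : probability Omega R.

Lemma degree_moves (St : finType) (move : V -> St -> V) x :
  injective (move x) -> (forall y, reflect (exists s, y = move x s) (adj x y)) ->
  degree adj x = #|St|.
Proof.
move=> mi adjP; rewrite /degree.
set l := [seq move x s | s <- enum St].
have lE : seq_fset tt l =i l by exact: seq_fsetE.
have e : [set y | adj x y] = [set` seq_fset tt l].
  apply/seteqP; split=> y hy.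
    suff : y \in seq_fset tt l by [].
    by rewrite lE; have [s ->] := elimT (adjP y) hy; rewrite map_f // mem_enum.
  have : y \in seq_fset tt l by [].
  by rewrite lE => /mapP[s _ ->]; apply/adjP; exists s.
rewrite e set_fsetK size_seq_fset undup_id; first by rewrite size_map -cardE.
by rewrite map_inj_uniq ?enum_uniq.
Qed.

Lemma pr_walk_follows (St : finType) (move : V -> St -> V) (L : nat)
    (S : V -> nat -> nat -> Omega -> V) x (t : L.-tuple St) :
  (forall x, injective (move x)) ->
  (forall x y, reflect (exists s, y = move x s) (adj x y)) ->
  simple_random_walk P adj x (S x 0%N) ->
  pr P (follows S move L x t) = (#|St|%:R : R)^-1 ^+ L.
Proof.
move=> mi adjP [mS S0 SM]; pose v := position move x t.
suff H n : (n <= L)%N -> P [set w | forall k, (k <= n)%N -> S x 0%N k w = v k] =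
    ((#|St|%:R : R)^-1 ^+ n)%:E.
  by rewrite /pr (_ : follows _ _ _ _ _ = [set w | forall k, (k <= L)%N -> S x 0%N k w = v k]) ?H.
elim: n => [_|n IH nL].
  rewrite expr0 -S0; congr (P _); apply/seteqP; split=> w /=.
    by move=> /(_ 0%N); rewrite /v /position take0; apply.
  by move=> e [|k] //; rewrite /v /position take0.
rewrite SM IH ?(ltnW nL) // exprSr EFinM; congr (_ * _%:E)%E.
rewrite /srw_step /v (positionS move x t nL).
set y := position _ _ _ _; have a : adj y (move y (tnth t (Ordinal nL))).
  by apply/adjP; exists (tnth t (Ordinal nL)).
by rewrite a (degree_moves (mi y) (adjP y)).
Qed.

Definition regular_walks (S : V -> nat -> nat -> Omega -> V) : set Omega :=
  [set w | forall x i, S x i 0%N w = x /\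
     forall n, adj (S x i n w) (S x i n.+1 w)].

(** The Markov property gives probability 0 to each finite prefix with a forbidden step, and there
    are countably many prefixes. *)
Lemma regular_walks_ae (S : V -> nat -> nat -> Omega -> V) :
  (forall x i, simple_random_walk P adj x (S x i)) ->
  exists2 B : set Omega, measurable B /\ P B = 0%E & ~` regular_walks S `<=` B.
Proof.
move=> hS.
(* [Some (s, n)]: the walk follows the list [s] up to time [n + 1] although its step at time [n] is
   forbidden; [None]: it starts at a wrong point. *)
pose Q (a : (V * nat) * option (seq V * nat)) w : Prop :=
  let: (x, i, o) := a in
  if o is Some (s, n) then ~~ adj (nth x s n) (nth x s n.+1) /\
    forall k, (k <= n.+1)%N -> S x i k w = nth x s k
  else ~ S x i 0%N w = x.
have mQ a : measurable [set w | Q a w].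
  case: a => -[x i] [[s n]|] /=.
    apply: measurable_cond => _.
    by apply: (@measurable_before _ _ n.+2) => k; exact: (srw_measurable (hS x i)).
  exact/measurable_not/(srw_measurable (hS x i)).
exists [set w | exists a, Q a w].
  split; first exact: measurable_exists.
  apply: null_exists => // -[[x i] [[s n]|]] /=.
    case: (boolP (adj (nth x s n) (nth x s n.+1))) => [_|na].
      by rewrite (_ : [set w | _] = set0) ?measure0 //; apply/seteqP; split=> w // [].
    rewrite (_ : [set w | _] = [set w | forall k, (k <= n.+1)%N -> S x i k w = nth x s k]).
      by rewrite (srw_markov (hS x i)) /srw_step (negPf na) mule0.
    by apply/seteqP; split=> w /= => [[]|].
  have mS0 : measurable [set w | S x i 0%N w = x] by exact: (srw_measurable (hS x i)).
  rewrite -[X in P X]/(~` [set w | S x i 0%N w = x]) probability_setC //.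
  by rewrite (srw_start (hS x i)) subee.
move=> w /= nr; apply: contrapT => nQ; apply: nr => x i; split.
  by apply: contrapT => h; apply: nQ; exists (x, i, None).
move=> n; case: (boolP (adj _ _)) => // na; case: nQ.
exists (x, i, Some (mkseq (fun k => S x i k w) n.+2, n)); split.
  by rewrite !nth_mkseq.
by move=> k kn; rewrite nth_mkseq.
Qed.

End WalkLaw.

Section Lattice.
Variable d : nat.

Lemma unit_stepE (s : 'I_d * bool) j :
  unit_step s 0 j = if j == s.1 then (-1) ^+ s.2 else 0.
Proof. by rewrite /unit_step !mxE eqxx /=; case: eqP => _; rewrite ?mulr1 ?mulr0. Qed.

Lemma step_inj (x : 'rV[int]_d) : injective (step x).
Proof.
move=> [i b] [i' b'] /addrI e.
have := congr1 (fun u : 'rV_d => u 0 i) e; rewrite !unit_stepE /= eqxx.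
case: eqP => [->|_]; last by case: b {e}.
by case: b {e}; case: b'.
Qed.

Lemma Zd_adjP (x y : 'rV[int]_d) : reflect (exists s, y = step x s) (Zd_adj x y).
Proof.
apply: (iffP eqP) => [e|[s ->]]; last first.
  rewrite (bigD1 s.1) //= big1 => [|j /negPf js].
    rewrite mxE unit_stepE eqxx opprD addNKr normrN normrX normrN1 expr1n addr0 //.
  by rewrite mxE unit_stepE js addr0 subrr normr0.
have [i hi] : exists i, x 0 i - y 0 i != 0.
  apply/existsP; rewrite -negb_forall; apply/negP => /forallP h.
  by move: e; rewrite big1 // => i _; apply/eqP; rewrite normr_eq0 h.
move: e; rewrite (bigD1 i) //= => e.
have s0 : 0 <= \sum_(j < d | j != i) `|x 0 j - y 0 j| by apply: sumr_ge0.
have e1 : `|x 0 i - y 0 i| = 1.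
  by move: e s0 hi; set z := x 0 i - y 0 i; set t := \sum_(_ < _ | _) _; lia.
have e0 : \sum_(j < d | j != i) `|x 0 j - y 0 j| = 0.
  by move: e; rewrite e1 -[RHS]addr0 => /addrI.
(* Nonnegative integers with sum 1 have a single nonzero term. A difference [x - y] equal to 1 is a
   backward step, encoded by [true]. *)
exists (i, x 0 i - y 0 i == 1); apply/rowP => j; rewrite mxE unit_stepE /=.
have [->|ji] := eqVneq j i.
  by move: e1; set a := x 0 i; set b := y 0 i; case: eqP => h; rewrite ?expr1 ?expr0; lia.
have := psumr_eq0P (fun j _ => normr_ge0 (x 0 j - y 0 j)) e0 ji.
by move/eqP; rewrite normr_eq0 subr_eq0 addr0 => /eqP.
Qed.

End Lattice.

(** * Survival *)

Section Lifetime.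
Context {R : realType} {d : measure_display} {Omega : measurableType d}.
Variable P : probability Omega R.

(** Only the lifetimes [L + 1, ..., L + n] are counted, so that finite additivity suffices. *)
Lemma pr_lifetime_ge (p : R) (X : {RV P >-> \bar R}) (L n : nat) :
  geometric_lifetime p X -> 0 <= p -> p < 1 ->
  p ^+ L * (1 - p ^+ n) <= pr P [set w | (L%:R%:E < X w)%E].
Proof.
move=> gX p0 p1.
have mk k : measurable [set w | X w = k%:R%:E].
  by rewrite -[X in measurable X]setTI; exact: (measurable_funPT X measurableT [set k%:R%:E]).
have mL : measurable [set w | (L%:R%:E < X w)%E].
  rewrite -[X in measurable X]setTI.
  have -> : [set w | (L%:R%:E < X w)%E] = X @^-1` `]L%:R%:E, +oo[.
    by apply/seteqP; split=> w /=; rewrite in_itv /= andbT.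
  by apply: (measurable_funPT X measurableT); exact: emeasurable_itv.
have prk (j : 'I_n) : pr P ([set w | (L%:R%:E < X w)%E] `&` [set w | X w = (L + j).+1%:R%:E])
    = (1 - p) * p ^+ (L + j).
  rewrite (_ : _ `&` _ = [set w | X w = (L + j).+1%:R%:E]).
    by rewrite /pr (lifetime_pmf gX).
  apply/seteqP; split=> w /= => [[]//|e]; split=> //.
  by rewrite e lte_fin ltr_nat ltnS leq_addr.
have sumE : \sum_(j < n) (1 - p) * p ^+ (L + j) = p ^+ L * (1 - p ^+ n).
  elim: n {prk} => [|n IH]; first by rewrite big_ord0 expr0 subrr mulr0.
  by rewrite big_ord_recr /= IH exprD exprS; ring.
rewrite -sumE -(eq_bigr _ (fun j _ => prk j)) pr_sum //; last first.
  by move=> i j w /= -> [] /eqP; rewrite eqr_nat eqSS eqn_add2l => /eqP /val_inj.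
apply: pr_le => //.
apply: measurableI => //.
exact: (@measurable_exists _ _ 'I_n (fun j w => X w = (L + j).+1%:R%:E)).
Qed.

End Lifetime.

Lemma one_sub_power_ge (R : realFieldType) (e : R) n :
  0 <= e -> e <= 1 -> 1 - n%:R * e <= (1 - e) ^+ n.
Proof.
move=> e0 e1; elim: n => [|n IH]; first by rewrite mul0r subr0 expr0.
rewrite exprS; apply: le_trans (ler_wpM2l _ IH); last by rewrite subr_ge0.
have : 0 <= (n%:R : R) * e * e by rewrite !mulr_ge0.
rewrite -natr1; lra.
Qed.

(** For [M > 1/e], [(1 - e)^M <= (1 - 1/M)^M <= 1/2]. *)
Lemma exists_small_power (R : archiRealFieldType) (e : R) j : 0 < e -> e <= 1 ->
  exists2 M, (0 < M)%N & (1 - e) ^+ (M * j) <= 2%:R^-1 ^+ j.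
Proof.
move=> e0 e1; pose M := (Num.bound e^-1).
have hM : e^-1 < M%:R by apply: archi_boundP; rewrite invr_ge0 ltW.
have M0 : (0 < M)%N by rewrite -(ltr_nat R) (lt_trans _ hM) ?invr_gt0.
exists M => //; rewrite exprM.
rewrite lerXn2r ?nnegrE ?exprn_ge0 ?subr_ge0 ?invr_ge0 //.
apply: le_trans (power_half R M0).
rewrite lerXn2r ?nnegrE ?subr_ge0 //.
  by rewrite invf_le1 ?ltr0n // ler1n.
rewrite lerD2l lerN2 -[leRHS]invrK lef_pV2 ?posrE ?ltr0n ?invr_gt0 //.
exact: ltW.
Qed.

(** * Geometry of the boxes and the lower bound for late activations *)

Section Survival.
Context {R : realType} (dim : nat) (i0 i1 : 'I_dim).
Hypothesis i01 : i0 != i1.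
Context {d : measure_display} {Omega : measurableType d}.
Variable P : probability Omega R.
Local Notation V := 'rV[int]_dim.
Local Notation St := ('I_dim * bool)%type.
Variables (eta : V -> {RV P >-> nat}) (S : V -> nat -> nat -> Omega -> V)
          (Xi : V -> nat -> {RV P >-> \bar R}).
Variables (p : R) (mu : probability nat R).
Hypothesis model : frog_model (@Zd_adj dim) eta S Xi p mu.
Variables (r n : nat).
Hypothesis r_gt0 : (0 < r)%N.

(* The particles live long enough to spread, and for the particle of the origin
   to cross a block in a straight line. *)
Let L := (n + 5 * r)%N.
Local Notation path := (L.-tuple St).
Local Notation proj := (plane_proj i0 i1).

(** Centres are [5 r] apart while boxes have radius [2 r], so boxes are disjoint; the shift by [3 r]
    keeps the origin out of all of them. *)
Definition center (b : block) : int * int :=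
  ((3 * r + 5 * r * b.1)%N%:Z, (5 * r * b.2)%N%:Z).

Definition box (b : block) : pred V :=
  fun x => (radius (proj x - center b)%R <= 2 * r)%N.

Definition visits (x : V) (o : option path) : pred V :=
  fun y => if o is Some t then y \in trajectory (@step dim) x t else false.

(** The first [r] distinct sites visited in the box; [insub] gives [None] when there are fewer. *)
Definition spread (b : block) (x : V) (o : option path) : option (r.-tuple V) :=
  if o is Some t then
    insub (take r (undup [seq y <- trajectory (@step dim) x t | box b y]))
  else None.

Lemma box_inj b b' x : box b x -> box b' x -> b = b'.
Proof.
case: b b' => [i j] [i' j']; rewrite /box /radius /= !geq_max.
set a := x 0 i0; set c := x 0 i1 => /andP[h1 h2] /andP[h3 h4].
have aux u v : (5 * r * u <= 5 * r * v + 4 * r)%N -> (u <= v)%N.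
  move=> h; rewrite -ltnS; have : (5 * r * u < 5 * r * v.+1)%N.
    by apply: leq_ltn_trans h _; rewrite [X in (_ < X)%N]mulnS; lia.
  by rewrite ltn_pmul2l // muln_gt0.
by congr (_, _); apply/eqP; rewrite eqn_leq; apply/andP; split; apply: aux; lia.
Qed.

Lemma origin_notin_box b : ~~ box b 0.
Proof. by rewrite /box /radius /= !mxE -ltnNge leq_max; apply/orP; left; lia. Qed.

(** [7 r] is the radius [2 r] plus the spacing [5 r]; a block which is its own neighbour is even
    closer. *)
Lemma neighbour_box b b' x : b' \in neighbours b -> box b x ->
  (radius (proj x - center b')%R <= 7 * r)%N.
Proof.
have succ u v : (`|u - v%:Z| <= 2 * r)%N ->
    (`|u - (5 * r + v)%N%:Z| <= 7 * r)%N by lia.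
have pred u v i : (`|u - (v + 5 * r * i)%N%:Z| <= 2 * r)%N ->
    (`|u - (v + 5 * r * i.-1)%N%:Z| <= 7 * r)%N.
  by case: i => [|i] /=; [|rewrite mulnS]; lia.
have pred0 u i : (`|u - (5 * r * i)%N%:Z| <= 2 * r)%N ->
    (`|u - (5 * r * i.-1)%N%:Z| <= 7 * r)%N by exact: (@pred u 0%N).
have near u (v : nat) : (`|u - v%:Z| <= 2 * r)%N -> (`|u - v%:Z| <= 7 * r)%N by lia.
rewrite /box /radius !geq_max !inE.
case/or4P => /eqP -> /andP[h1 h2]; apply/andP; split;
  try exact: near; try exact: pred; try exact: pred0; rewrite /center /= mulnS.
- by rewrite addnCA; exact: succ.
- exact: succ.
Qed.

Lemma spreadE b x (t : path) : spread b x (Some t) = spreads i0 i1 r (center b) x t :> bool.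
Proof.
rewrite /spread; set l := undup _; rewrite /spreads -/l.
have e : (size (take r l) == r) = (r <= size l)%N.
  by rewrite size_take; case: ltngtP => //; lia.
by case: insubP => [u|]; rewrite e // => /negPf ->.
Qed.

Lemma spreadP b x o M : spread b x o = Some M ->
  uniq M /\ {in M, forall y, box b y /\ visits x o y}.
Proof.
case: o => // t; rewrite /spread; set l := undup _.
case: insubP => // M' _ eM [<-]; rewrite eM; split.
  by rewrite take_uniq // undup_uniq.
move=> y yM; have /mem_take : y \in take r l by rewrite -eM.
by rewrite mem_undup mem_filter => /andP[].
Qed.

Local Notation theta := (frog_prob eta Xi L).
Local Notation prob := (outcome_prob (St := St) eta Xi (L := L)).

Variable theta0 : R.
Hypothesis theta0_gt0 : 0 < theta0.
Hypothesis theta_ge : forall x, theta0 <= theta x.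
Hypothesis spreads_often_n : forall c x, (radius (proj x - c)%R <= 7 * r)%N ->
  16%:R^-1 ^+ 13 <= average R n (spreads i0 i1 r c x).

Hypothesis delta_small : 4%:R * (1 - theta0 * 16%:R^-1 ^+ 13) ^+ r <= 324%:R^-1.

Lemma spread_prob b b' x : b' \in neighbours b -> box b x ->
  theta0 * 16%:R^-1 ^+ 13 <= \sum_(o | spread b' x o) prob x o.
Proof.
move=> hb hx.
rewrite big_mkcond sum_option /= add0r -big_mkcond /=.
rewrite (eq_bigl (fun t : path => spreads i0 i1 r (center b') x t)); last first.
  by move=> t; exact: spreadE.
rewrite -mulr_sumr -average_tuple.
apply: ler_pM; [exact: ltW|by rewrite exprn_ge0 ?invr_ge0|exact: theta_ge|].
apply: le_trans (spreads_often_n (neighbour_box hb hx)) _.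
(* Spreading within [n] steps persists up to the longer time [L]. *)
apply: average_mono; [exact: (St_gt0 i0)|exact: spreads_rcons|exact: leq_addr].
Qed.

(** A measurable null event, fixed once and for all, outside which all walks start at their site and
    follow the edges. *)
Let B := s2val (cid2 (regular_walks_ae (frog_walk model))).

Lemma measurable_B : measurable B.
Proof. by rewrite /B; case: cid2 => ? []. Qed.

Lemma P_B : P B = 0%E.
Proof. by rewrite /B; case: cid2 => ? []. Qed.

Lemma regular_notin_B w : ~ B w -> regular_walks (@Zd_adj dim) S w.
Proof. by rewrite /B; case: cid2 => ? /= _ h nB; apply: contrapT => /h. Qed.

Lemma mem_trajectory (x y : V) (t : seq St) :
  y \in trajectory (@step dim) x t -> exists2 k, (k <= size t)%N & y = position (@step dim) x t k.
Proof.
elim: t x => [|s t IH] x.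
  by rewrite inE => /eqP ->; exists 0%N.
rewrite trajectory_cons inE => /orP[/eqP ->|/IH[k kt ->]]; first by exists 0%N.
by exists k.+1.
Qed.

Lemma position_trajectory (x : V) (t : seq St) k :
  position (@step dim) x t k \in trajectory (@step dim) x t.
Proof.
elim: t x k => [|s t IH] x [|k]; rewrite ?mem_head //.
by rewrite trajectory_cons inE [_ \in _](IH (step x s) k) orbT.
Qed.

Local Notation event := (history_event eta S Xi (@step dim) (L := L)).

Lemma active_activated h x w : active visits 0 h x -> event h w ->
  activated 0 eta S Xi w x.
Proof.
move=> + hw; elim=> {x} [|x o y _ IH xo]; first exact: activated_root.
case: o xo => // t xo yt; have [k] := mem_trajectory yt; rewrite size_tuple => kL ey.
have [e0 [ft ll]] := hw _ _ xo.
apply: (activated_step IH (i := 0%N) (n := k)); split => //.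
- by apply: le_lt_trans ll; rewrite lee_fin ler_nat.
- by rewrite ft ?ltnS // ey.
Qed.

(** Points of the box of [b] have first coordinate at least [r + 5 r b.1 > k], and activation takes
    at least that long. *)
Lemma active_late k h b x w : (k <= b.1)%N -> box b x -> active visits 0 h x ->
  event h w -> ~ B w -> late 0 eta S Xi k w.
Proof.
move=> kb bx ax hw /regular_notin_B reg.
have [m Tx] := active_activated ax hw; exists x, m; split=> //.
have := @activation_time_ge R V 0 d Omega P eta S Xi (fun z : V => z 0 i0) w.
rewrite mxE => /(_ erefl _ _ x m Tx) le_m.
have : x 0 i0 <= m%:Z.
  apply: le_m => [y i|y i j]; first by case: (reg y i).
  have [_ /(_ j) /Zd_adjP[s ->]] := reg y i.
  by rewrite mxE unit_stepE lerD2l; case: eqP => _ //; case: s.2.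
move: bx; rewrite /box /radius geq_max /= => /andP[+ _].
have : (b.1 <= r * b.1)%N by rewrite leq_pmull.
have -> : (5 * r * b.1 = 5 * (r * b.1))%N by rewrite mulnA.
set a := x 0 i0; set c := (r * b.1)%N; lia.
Qed.

Definition forward : St := (i0, false).

Definition axis (k : nat) : V := iter k (fun x => step x forward) 0.

Lemma proj_axis k : proj (axis k) = (k%:Z, 0).
Proof.
elim: k => [|k IH]; first by rewrite /plane_proj /= !mxE.
rewrite /axis iterS plane_proj_step // IH /plane_move eqxx /= expr0; congr (_, _); lia.
Qed.

Lemma position_axis k : (k <= L)%N ->
  position (@step dim) 0 (nseq_tuple L forward) k = axis k.
Proof.
move=> kL; rewrite /position /= take_nseq // /axis.
by move: (0 : V); elim: k {kL} => // k IH x; rewrite iterSr -IH.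
Qed.

(** The first factor is the probability that the particle of the origin runs straight along the
    axis, activating [r] sites of block [(0, 0)]; given this, the exploration gets far with
    probability at least 1/2. *)
Lemma late_ge k :
  prob 0 (Some (nseq_tuple L forward)) / 2%:R <= pr P (late 0 eta S Xi k).
Proof.
have mS x i j y : measurable (S x i j @^-1` [set y]).
  exact: (srw_measurable (frog_walk model x i)).
have mlate := measurable_late 0 eta Xi mS k.
(* The null event [B] is added to absorb the irregular realisations. *)
pose A := late 0 eta S Xi k `|` B.
have mA : measurable A by apply: measurableU => //; exact: measurable_B.
have AE : pr P A <= pr P (late 0 eta S Xi k).
  rewrite -lee_fin -!prE //.
  have : (P A <= P (late (0 : V)%R eta S Xi k) + P B)%E.
    by apply: measureU2 => //; exact: measurable_B.
  by rewrite P_B adde0.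
apply: le_trans AE.
set t0 := nseq_tuple L forward.
pose h0 : seq (V * option path) := [:: (0, Some t0)].
have mi (x : V) : injective (@step dim x) by exact: step_inj.
have pf x (t : path) : pr P (follows S (@step dim) L x t) = (#|{: St}|%:R : R)^-1 ^+ L.
  by apply: (pr_walk_follows t mi (@Zd_adjP dim)); exact: (frog_walk model).
have mh (h : seq (V * option path)) : measurable (event h) by exact: measurable_history.
have prh (h : seq (V * option path)) : uniq (map fst h) ->
    pr P (event h) = \prod_(a <- h) prob a.1 a.2.
  by apply: pr_history => //; [exact: (St_gt0 i0)|exact: (frog_independent model)].
(* The points of the axis at distance [r + 1] to [2 r], inside the box of radius [2 r] about
   [(3 r, 0)]. *)
have [uM0 aM0] : uniq (mktuple (fun j : 'I_r => axis (r + j).+1)) /\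
    forall x, x \in mktuple (fun j : 'I_r => axis (r + j).+1) ->
      exists2 j : nat, (j < r)%N & x = axis (r + j).+1.
  split; last by move=> x /mapP[j _ ->]; exists j.
  rewrite map_inj_uniq ?enum_uniq // => j j' /(congr1 proj).
  by rewrite !proj_axis => -[e]; apply: val_inj => /=; lia.
set M0 := mktuple _ in uM0 aM0.
have pge x o : 0 <= prob x o by exact: outcome_prob_ge0.
have psum x : \sum_o prob x o = 1 by apply: outcome_prob_sum1; exact: (St_gt0 i0).
have kappa1 : theta0 * 16%:R^-1 ^+ 13 <= 1.
  apply: mulr_ile1; [exact: ltW|by rewrite exprn_ge0 ?invr_ge0| |].
    by apply: le_trans (theta_ge 0) _; apply: frog_prob_le1.
  by rewrite exprn_ile1 ?invr_ge0 //; lra.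
have bw b (M : r.-tuple V) : uniq M -> all (box b) M ->
    \sum_(g | ~~ good spread b M g) weight prob M g <=
    4%:R * (1 - theta0 * 16%:R^-1 ^+ 13) ^+ r.
  by move=> _; apply: bad_weight_le => // b1 b2 x; exact: spread_prob.
have d0 : 0 <= 4%:R * (1 - theta0 * 16%:R^-1 ^+ 13) ^+ r :> R.
  by rewrite mulr_ge0 // exprn_ge0 // subr_ge0.
pose out (M : r.-tuple V) (g : {ffun 'I_r -> option path}) : set Omega :=
  [set w | forall i, outcome_event eta S Xi (@step dim) (tnth M i) (g i) w].
have mout M g : measurable (out M g).
  by apply: measurable_forall => i; exact: measurable_outcome.
have event_extend h M g : event (extend h M g) = event h `&` out M g.
  rewrite /extend history_cat; congr (_ `&` _); apply/seteqP; split=> w hw.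
    by move=> i; apply: hw; apply/mapP; exists i; rewrite ?mem_enum.
  by move=> x o /mapP[i _ [-> ->]]; exact: hw.
pose alpha h := pr P (event h `&` A).
have h0E : pr P (event h0) = prob 0 (Some t0) by rewrite prh // big_seq1.
rewrite -h0E; apply: (@le_trans _ _ (alpha h0)); last first.
  by apply: pr_le => //; exact: measurableI.
apply: (half_le_alpha pge psum box_inj spreadP d0 bw r_gt0
  (pi := fun h => pr P (event h)) (visits := visits) (root := 0 : V) (k := k) _ _ _ _ _ (M := M0)).
- by move=> h; exact: pr_ge0.
- by move=> h; exact: pr_ge0.
- move=> h M g uhM; rewrite prh ?keys_extend // prh; last first.
    by move: uhM; rewrite cat_uniq => /andP[].
  by rewrite /extend big_cat /= big_map big_enum.
- move=> h M _; rewrite /alpha.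
  rewrite (eq_bigr (fun g => pr P (event h `&` A `&` out M g))); last first.
    by move=> g _; rewrite event_extend setIAC.
  rewrite pr_sum //.
  + have mhA := measurableI _ _ (mh h) mA; apply: pr_le => //.
    apply: measurableI => //.
    apply: (@measurable_exists _ _ {ffun 'I_r -> option path} (out M)) => g.
    exact: mout.
  + exact: measurableI.
  + move=> g g' w hg hg'; apply/ffunP => i; exact: outcome_inj (hg i) (hg' i).
- move=> h b x uh kb bx ax; apply: pr_le => //; first exact: measurableI.
  move=> w hw; split=> //; have [Bw|nBw] := pselect (B w); [by right|left].
  exact: active_late kb bx ax hw nBw.
- by have := delta_small; lra.
- by [].
- exact: uM0.
- apply/allP => x /aM0[j jr ->]; rewrite /box proj_axis /radius /=; lia.
- by move=> x b; rewrite inE => /eqP ->; exact: origin_notin_box.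
- move=> x /aM0[j jr ->]; apply: (active_visit (x := 0) (o := Some t0)).
  + exact: active_root.
  + exact: mem_head.
  + have jL : ((r + j).+1 <= L)%N by rewrite /L; lia.
    by rewrite /visits -(position_axis jL); exact: position_trajectory.
Qed.

End Survival.

(** * Choice of the constants and conclusion *)

Theorem theorem1p4 (R : realType) (disp : measure_display)
    (Omega0 : measurableType disp) (P0 : probability Omega0 R)
    (eta : {RV P0 >-> nat}) (heta : (0 < P0 [set w | (1 <= eta w)%N])%E)
    (d : nat) (hd : (2 <= d)%N) :
  (critical_parameter (@Zd_adj d) (0 : 'rV[int]_d)%R (distribution P0 eta) < 1)%E.
Proof.
set q := pr P0 [set w | (1 <= eta w)%N].
have mq : measurable [set w | (1 <= eta w)%N].
  rewrite -[X in measurable X]setTI.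
  exact: (measurable_funPT eta measurableT [set k | (0 < k)%N]).
have q0 : 0 < q by rewrite -lte_fin -prE.
have q1 : q <= 1 by exact: pr_le1.
pose i0 : 'I_d := Ordinal (ltnW hd); pose i1 : 'I_d := Ordinal hd.
have i01 : i0 != i1 by [].
(* One factor 1/2 is for surviving [L] steps, the other for cutting off the geometric law. Since
   [theta0] does not involve the survival parameter, [r], [n] and [L] can be fixed before it. *)
pose theta0 := q / 4%:R.
have theta0_gt0 : 0 < theta0 by rewrite divr_gt0.
pose c : R := 16%:R^-1 ^+ 13.
have c0 : 0 < c by rewrite exprn_gt0 // invr_gt0.
have c1 : c <= 1 by rewrite exprn_ile1 ?invr_ge0 //; lra.
(* The exponent 11 serves [4 * 2^-11 = 1/512 <= 1/324], where [324 = 4 * 81]. *)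
have [M M0 hM] : exists2 M, (0 < M)%N & (1 - theta0 * c) ^+ (M * 11) <= 2%:R^-1 ^+ 11.
  apply: exists_small_power; first exact: mulr_gt0.
  by apply: mulr_ile1; rewrite ?(ltW c0) ?(ltW theta0_gt0) // /theta0; lra.
set r := (M * 11)%N in hM; have r0 : (0 < r)%N by rewrite muln_gt0 M0.
have [n hn] := spreads_often R i01 r.
set L := (n + 5 * r)%N; have L0 : (0 < L)%N by rewrite addn_gt0 muln_gt0 r0 orbT.
(* With parameter [1 - e], Bernoulli's inequality gives [(1 - e)^L >= 1 - L e = 1/2]. *)
pose e : R := (2 * L)%:R^-1.
have e0 : 0 < e by rewrite invr_gt0 ltr0n muln_gt0.
have e1 : e <= 1 by rewrite invf_le1 ?ltr0n ?ler1n muln_gt0.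
have [K _ hK] := exists_small_power 1 e0 e1; rewrite muln1 expr1 in hK.
have pL : 2%:R^-1 <= (1 - e) ^+ L.
  apply: le_trans (one_sub_power_ge L (ltW e0) e1).
  rewrite /e natrM invfM mulrCA divff ?mulr1 ?pnatr_eq0 -?lt0n //; lra.
apply: (@le_lt_trans _ _ (1 - e)%:E); last first.
  by rewrite lte_fin gtrBl.
apply: ereal_inf_lbound; exists (1 - e) => //; split.
  by rewrite subr_ge0 e1 gerBl ltW.
move=> d' Omega P eta' S Xi model.
have theta_ge x : theta0 <= frog_prob eta' Xi L x.
  have -> : theta0 = q * 4%:R^-1 by [].
  apply: ler_pM; [exact: ltW|by rewrite invr_ge0| |].
    rewrite /q /pr -[P0 _]/(distribution P0 eta [set k | (1 <= k)%N]).
    by rewrite -(frog_eta model x).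
  apply: le_trans (pr_lifetime_ge L K (frog_lifetime model x 0%N) _ _).
  - have : 0 <= (1 - e) ^+ K by rewrite exprn_ge0 // subr_ge0.
    move: pL hK; set a := _ ^+ L; set b := _ ^+ K; nra.
  - by rewrite subr_ge0.
  - by rewrite gtrBl.
have small : 4%:R * (1 - theta0 * c) ^+ r <= 324%:R^-1.
  by move: hM; set y := _ ^+ r; lra.
have hs cc x : (radius (plane_proj i0 i1 x - cc)%R <= 7 * r)%N ->
    c <= average R n (spreads i0 i1 r cc x) by exact: hn.
have mS x i j y : measurable (S x i j @^-1` [set y]).
  exact: (srw_measurable (frog_walk model x i)).
have late_prob k := late_ge i01 model r0 theta0_gt0 theta_ge hs small k.
(* The lower bound of [late_ge] is positive and does not depend on [k], so it passes to survival. *)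
apply: lt_le_trans (survival_ge mS (c := outcome_prob eta' Xi (L := L) 0
  (Some (nseq_tuple L (forward i0))) / 2%:R) _); last first.
  by move=> k; rewrite prE ?lee_fin //; exact: measurable_late.
rewrite lte_fin divr_gt0 //= mulr_gt0 //.
  exact: lt_le_trans theta0_gt0 (theta_ge 0).
by rewrite exprn_gt0 // invr_gt0 ltr0n; apply/card_gt0P; exists (i0, true).
Qed.
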